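(* Let $X$ be a compact Hausdorff space with a free interval $J$ and let $\Phi$ be an action of an abelian semigroup $S$ on $X$. Assume that $M\subseteq X$ is a minimal set for $\Phi$ which intersects $J$. If all the acting maps $\varphi_s$ of $\Phi$ are homeomorphisms of $X$, then exactly one of the following conditions holds: (1) $M$ is finite; (2) $M$ is open in $X$ and it is a disjoint union of finitely many circles; (3) $M$ is a nowhere dense Cantor set in $X$.
   Context: A free interval $J$ in a topological space $X$ is an open subset of $X$ homeomorphic to the open interval $(0,1)$. Semigroups are nonempty and carry the discrete topology. An action of an abelian semigroup $S$ on $X$ is a continuous map $\Phi\colon S\times X\to X$ with $\Phi(s,\Phi(t,x))=\Phi(s+t,x)$ for all $s,t\in S$, $x\in X$; its acting maps are $\varphi_s=\Phi(s,\cdot)$. A minimal set of $\Phi$ is a nonempty closed subset $M\subseteq X$ with $\varphi_s(M)\subseteq M$ for every $s\in S$, having no proper subset with these three properties (nonempty, closed, invariant). A Cantor set is a space homeomorphic to the standard Cantor set. ''$M$ is a disjoint union of finitely many circles'' means that $M$, with the subspace topology, is homeomorphic to the topological disjoint union of finitely many copies of $\mathbb S^1$. *)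

(* Defs.v *)
From HB Require Import structures.
From mathcomp Require Import all_boot all_order all_algebra.
From mathcomp Require Import all_classical all_reals all_analysis.

Set Implicit Arguments.
Unset Strict Implicit.
Unset Printing Implicit Defensive.

Import Order.TTheory GRing.Theory Num.Theory.
Import numFieldNormedType.Exports.

Local Open Scope classical_set_scope.
Local Open Scope ring_scope.

Definition homeomorphism (X Y : topologicalType) (f : X -> Y) : Prop :=
  continuous f /\
  exists g : Y -> X, [/\ continuous g, cancel f g & cancel g f].

Definition homeomorphic (X Y : topologicalType) : Prop :=
  exists f : X -> Y, homeomorphism f.

(* A subset [A] used as a space is [set_type A], with the subtype topology. *)
Definition free_interval (R : realType) (X : topologicalType) (J : set X) :
    Prop :=
  open J /\ homeomorphic (set_type J) (set_type (`]0, 1[%classic : set R)).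

(* [addSemigroupType] is associative and commutative; [discrete_topology S] is
   [S] with the discrete topology, so [continuous] is joint continuity. *)
Definition is_action (S : addSemigroupType) (X : topologicalType)
    (Phi : discrete_topology S * X -> X) : Prop :=
  continuous Phi /\
  forall (s t : S) (x : X), Phi (s, Phi (t, x)) = Phi (s + t, x).

Definition acting_map (S : addSemigroupType) (X : topologicalType)
    (Phi : discrete_topology S * X -> X) (s : S) : X -> X :=
  fun x => Phi (s, x).

Definition nonempty_closed_invariant (S : addSemigroupType) (X : topologicalType)
    (Phi : discrete_topology S * X -> X) (M : set X) : Prop :=
  [/\ M !=set0, closed M & forall s : S, acting_map Phi s @` M `<=` M].

Definition minimal_set (S : addSemigroupType) (X : topologicalType)
    (Phi : discrete_topology S * X -> X) (M : set X) : Prop :=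
  nonempty_closed_invariant Phi M /\
  forall N : set X, nonempty_closed_invariant Phi N -> ~ N `<` M.

Definition nowhere_dense (X : topologicalType) (A : set X) : Prop :=
  interior (closure A) = set0.

Definition is_cantor_set (X : topologicalType) (M : set X) : Prop :=
  homeomorphic (set_type M) cantor_space.

Definition circle (R : realType) : topologicalType :=
  set_type [set p : R * R | p.1 ^+ 2 + p.2 ^+ 2 = 1].

(* [{i : 'I_n & circle R}] carries the disjoint union topology. *)
Definition is_finite_union_of_circles (R : realType) (X : topologicalType)
    (M : set X) : Prop :=
  exists n : nat, homeomorphic (set_type M) {i : 'I_n & circle R}.

Definition exactly_one (P Q T : Prop) : Prop :=
  [\/ P, Q | T] /\ [/\ ~ (P /\ Q), ~ (P /\ T) & ~ (Q /\ T)].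

(* Main.v *)
(* Commutativity of [S] makes every image of [M] under an acting map invariant,
   so the acting maps permute [M], and every orbit in [M] is dense in [M].
   Hence a local property of one point of [M] holds at all of them: an isolated
   point makes [M] discrete, so finite, and an interior point makes [M] open.

   If [M] is open, pulling the chart [J] back along the acting maps covers [M] by
   finitely many arcs (open subsets homeomorphic to an open interval).  The union
   of an arc [U] with an arc [V] through a boundary point of [U] is an arc or a
   circle; adding arcs of the cover one by one must end with a circle, since an
   arc is never compact.  So [M] is a union of open circles, and circles that are
   open and meet are equal.

   If [M] is perfect with empty interior, the gaps of [M] in [J] give every point
   a clopen neighbourhood in [M] that a chart maps injectively into [(0, 1)].
   Finitely many of these pieces, laid side by side, embed [M] in the line as a
   compact perfect zero-dimensional set. *)
Require Import Defs.
From HB Require Import structures.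
From mathcomp Require Import all_boot all_order all_algebra.
From mathcomp Require Import all_classical all_reals all_analysis.
From mathcomp Require Import ring lra.

Set Implicit Arguments.
Unset Strict Implicit.
Unset Printing Implicit Defensive.

Import Order.TTheory GRing.Theory Num.Theory.
Import numFieldNormedType.Exports.

Local Open Scope classical_set_scope.
Local Open Scope ring_scope.

(** * Preliminaries on compact and Hausdorff spaces *)

Lemma compact_hausdorff_homeomorphism (X Y : topologicalType) (f : X -> Y) :
  compact [set: X] -> hausdorff_space Y -> continuous f -> injective f ->
  (forall y, exists x, f x = y) -> homeomorphism f.
Proof.
move=> cX hY cf fI fS; split=> //.
pose g y := projT1 (cid (fS y)).
have fK y : f (g y) = y by exact: projT2 (cid (fS y)).
have gK x : g (f x) = x by apply: fI; rewrite fK.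
exists g; split=> //; apply/continuousP => A oA; rewrite -[_ @^-1` _]setCK.
apply: closed_openC; suff -> : ~` (g @^-1` A) = f @` (~` A).
  apply: compact_closed => //; apply: continuous_compact.
    exact: continuous_subspaceT.
  by apply: (subclosed_compact _ cX) => //; exact: open_closedC.
apply/seteqP; split=> [y /= Agy|_ [x Ax <-] /=]; first by exists (g y).
by rewrite gK.
Qed.

Lemma compact_finite_subcover (X : topologicalType) (A : set X)
    (U : X -> set X) :
  compact A -> (forall x, A x -> nbhs x (U x)) ->
  exists2 s : seq X, (forall x, x \in s -> A x) &
    forall x, A x -> exists2 y, y \in s & U y x.
Proof.
move=> cA AU; apply: contrapT => noS.
(* If no finite [s] covers [A], the uncovered parts [N s] generate a proper filter on [A]. A cluster
   point [x] of it is impossible, since [N [:: x]] misses the neighbourhood [U x]. *)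
pose N (s : seq X) := A `\` [set x | exists2 y, y \in s & U y x].
pose D := [set s : seq X | forall x, x \in s -> A x].
pose F := filter_from D N.
have FP : ProperFilter F.
  apply: filter_from_proper; last first.
    move=> s Ds; apply: contrapT => N0; apply: noS; exists s => // x Ax.
    by apply: contrapT => Ux; apply: N0; exists x; split.
  apply: filter_from_filter; first by exists [::].
  move=> s t Ds Dt; exists (s ++ t).
    by move=> x; rewrite mem_cat => /orP[/Ds|/Dt].
  move=> x [Ax Nx]; split; split=> // -[y ys Uyx]; apply: Nx;
    exists y => //; by rewrite mem_cat ys ?orbT.
have [|x [Ax cx]] := cA F FP.
  by exists [::] => // x [].
have [|y [[_ Ny] Uy]] := cx (N [:: x]) (U x) _ (AU _ Ax).
  by exists [:: x] => // y; rewrite inE => /eqP ->.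
by apply: Ny; exists x; rewrite ?inE.
Qed.

Lemma compact_set_type (X : topologicalType) (A : set X) :
  compact A -> compact [set: set_type A].
Proof.
move=> cA F FP _.
have [|x [Ax clx]] := cA (set_val @ F) (fmap_proper_filter _ FP).
  by apply: (@filterE _ F) => y; exact: set_valP.
exists (@exist _ _ x (mem_set Ax)); split=> // B C FB [_ [[W oW <-] Wx] WC].
have [|_ [[y By <-] Wy]] := clx (set_val @` B) W _ (open_nbhs_nbhs (conj oW Wx)).
  by apply: (@filterS _ F _ B) FB => y By; exists y.
by exists y; split=> //; exact: WC.
Qed.

Lemma injective_hausdorff (X Y : topologicalType) (f : X -> Y) :
  continuous f -> injective f -> hausdorff_space Y -> hausdorff_space X.
Proof.
move=> cf fI hY x y clxy; apply/fI/hY => A B Ax By.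
by have [z [Az Bz]] := clxy _ _ (cf _ _ Ax) (cf _ _ By); exists (f z).
Qed.

Lemma hausdorff_set_type (X : topologicalType) (A : set X) :
  hausdorff_space X -> hausdorff_space (set_type A).
Proof.
apply: (@injective_hausdorff _ _ set_val); first exact: initial_continuous.
exact: val_inj.
Qed.

Lemma homeomorphic_sym (X Y : topologicalType) :
  homeomorphic X Y -> homeomorphic Y X.
Proof.
by move=> [f [cf [g [cg fK gK]]]]; exists g; split=> //; exists f; split.
Qed.

(** * Arcs *)

Definition oo (R : realType) (a b : R) : set R := [set t | a < t < b].

(* The last clause says that [h] is continuous and open at [t]. *)
Definition is_arc (R : realType) (X : topologicalType) (a b : R) (h : R -> X) :
    Prop :=
  [/\ a < b,
      forall s t, oo a b s -> oo a b t -> h s = h t -> s = t &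
      forall t, oo a b t -> forall A, nbhs (h t) A <-> nbhs t (h @^-1` A)].

Section Arcs.
Context {R : realType} {X : topologicalType}.
Implicit Types (a b c d m : R) (h k : R -> X).

Lemma itv_ooE a b : oo a b = `]a, b[%classic.
Proof. by rewrite set_itvoo. Qed.

Lemma nbhs_oo a b t : oo a b t -> nbhs t (oo a b).
Proof.
by move=> abt; apply: open_nbhs_nbhs; split=> //; rewrite itv_ooE.
Qed.

Lemma nbhs_ex_oo t (A : set R) : nbhs t A ->
  exists2 e, 0 < e & oo (t - e) (t + e) `<=` A.
Proof.
move=> /nbhs_ballP[e e0 eA]; exists e => // s /andP[s1 s2]; apply: eA.
by rewrite /ball /= ltr_norml; apply/andP; split; lra.
Qed.

Lemma oo_nbhs t e (A : set R) :
  0 < e -> oo (t - e) (t + e) `<=` A -> nbhs t A.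
Proof.
move=> e0 eA; apply: filterS eA _; apply: nbhs_oo; apply/andP; split; lra.
Qed.

Lemma nbhs_reflect s t (A : set R) :
  nbhs (s - t) A -> nbhs t [set u | A (s - u)].
Proof.
move=> /nbhs_ex_oo[e e0 eA]; apply: (oo_nbhs e0) => u /andP[u1 u2].
by apply: eA; apply/andP; split; lra.
Qed.

Lemma nbhs_opp t (A : set R) : nbhs (- t) A -> nbhs t [set u | A (- u)].
Proof.
by move=> tA; have := @nbhs_reflect 0 t A; rewrite sub0r => /(_ tA);
  apply: filterS => u; rewrite /= sub0r.
Qed.

Lemma is_arc_sub a b c d h :
  is_arc a b h -> a <= c -> d <= b -> c < d -> is_arc c d h.
Proof.
move=> [ab hI hN] ac db cd.
have sub t : oo c d t -> oo a b t by move=> /andP[? ?]; apply/andP; split; lra.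
by split=> // [s t /sub + /sub|t /sub]; [exact: hI|exact: hN].
Qed.

(** Reversing an arc reduces the statements about one of its ends to those about the other. *)
Lemma is_arc_opp a b h : is_arc a b h -> is_arc (- b) (- a) (h \o -%R).
Proof.
move=> [ab hI hN].
have sub t : oo (- b) (- a) t -> oo a b (- t).
  by move=> /andP[? ?]; apply/andP; split; lra.
split=> [|s t /sub + /sub|t /sub]; first by lra.
  by move=> hs ht /(hI _ _ hs ht) /oppr_inj.
move=> ht A; rewrite (hN _ ht); split=> [/nbhs_opp //|nA].
by apply: filterS (nbhs_opp (t := - t) _); last rewrite opprK; [|exact: nA];
   move=> u /=; rewrite opprK.
Qed.

Lemma oo_opp_image a b h : (h \o -%R) @` oo (- b) (- a) = h @` oo a b.
Proof.
apply/seteqP; split=> _ [t /andP[? ?] <-]; exists (- t) => //=; rewrite ?opprK //.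
all: by apply/andP; split; lra.
Qed.

Lemma arc_continuous a b h t : is_arc a b h -> oo a b t -> {for t, continuous h}.
Proof. by move=> [_ _ hN] abt A /(hN _ abt). Qed.

Lemma arc_within a b h (A : set R) :
  is_arc a b h -> A `<=` oo a b -> {within A, continuous h}.
Proof.
move=> ah Aab; apply: continuous_in_subspaceT => t /set_mem /Aab.
exact: arc_continuous.
Qed.

Lemma arc_image_nbhs a b h t (A : set R) :
  is_arc a b h -> oo a b t -> nbhs t A -> nbhs (h t) (h @` A).
Proof.
move=> [_ _ hN] abt tA; apply/(hN _ abt); apply: filterS tA.
by move=> s As; exists s.
Qed.

Lemma arc_open a b c d h :
  is_arc a b h -> a <= c -> d <= b -> open (h @` oo c d).
Proof.
move=> ah ac db; rewrite openE => _ [t cdt <-].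
apply: (arc_image_nbhs ah); last exact: nbhs_oo.
by move: cdt => /andP[? ?]; apply/andP; split; lra.
Qed.

Lemma arc_connected a b c d h :
  is_arc a b h -> a <= c -> d <= b -> connected (h @` oo c d).
Proof.
move=> ah ac db; apply: connected_continuous_connected.
  by rewrite itv_ooE; apply/connected_intervalP/interval_is_interval.
by apply: (arc_within ah) => t /andP[? ?]; apply/andP; split; lra.
Qed.

Lemma arc_segment_compact a b c d h :
  is_arc a b h -> a < c -> d < b -> compact (h @` `[c, d]%classic).
Proof.
move=> ah ac db; apply: continuous_compact; last exact: segment_compact.
apply: (arc_within ah) => t; rewrite set_itvcc => /andP[? ?].
by apply/andP; split; lra.
Qed.

(* [C] meets the compact arc [k [m, v]] in a set that is closed, and also open
   because the end points are missing. *)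
Lemma connected_sub_arc a b m v u (C : set X) k : hausdorff_space X ->
  is_arc a b k -> connected C -> a < m -> v < b -> ~ C (k m) -> ~ C (k v) ->
  oo m v u -> C (k u) -> C `<=` k @` oo m v.
Proof.
move=> hX ak cC am vb Cm Cv mvu Cu.
have -> : C = C `&` k @` oo m v; last by move=> x [].
have mv : m < v by move: mvu => /andP[? ?]; lra.
symmetry; apply: cC.
- by exists (k u); split=> //; exists u.
- by exists (k @` oo m v) => //; apply: (arc_open ak); lra.
- exists (k @` `[m, v]%classic).
    by apply: compact_closed => //; apply: (arc_segment_compact ak).
  apply/seteqP; split=> x [Cx [w mvw wx]]; split=> //; exists w => //.
    by move: mvw => /andP[? ?]; rewrite set_itvcc /=; apply/andP; split; lra.
  move: mvw; rewrite set_itvcc /= => /andP[mw wv]; apply/andP; split.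
    by rewrite lt_neqAle mw andbT; apply: contra_notN Cm => /eqP ->; rewrite wx.
  by rewrite lt_neqAle wv andbT; apply: contra_notN Cv => /eqP <-; rewrite wx.
Qed.

End Arcs.

(** * How one arc runs out of the end of another *)

Section ArcEnds.
Context {R : realType} {X : topologicalType}.
Hypothesis hX : hausdorff_space X.
Implicit Types (a b c d m u t v s : R) (h k : R -> X).

(** The point [h t] cuts the first arc into two connected sides. Each side misses both [k m] and
    [k u], so by [connected_sub_arc] it lies in the image of [oo m u] as soon as it meets it. Every
    point of that image is on some side, and the two sides cannot both lie in it. *)
Lemma arc_end_sides a b c d m h k u t :
  is_arc a b h -> is_arc c d k -> c < m ->
  k @` oo m d `<=` h @` oo a b -> ~ (h @` oo a b) (k m) ->
  oo m d u -> oo a b t -> k u = h t ->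
  k @` oo m u = h @` oo t b \/ k @` oo m u = h @` oo a t.
Proof.
move=> ah ak cm kU kmU /andP[mu ud] /andP[at_ tb] kuht.
have [ab hI _] := ah; have [cd kI _] := ak.
have side (p q : R) : a <= p -> q <= b -> (forall s, oo p q s -> s != t) ->
    forall w, oo m u w -> (h @` oo p q) (k w) ->
    h @` oo p q `<=` k @` oo m u.
  move=> ap qb pqt w muw kw.
  have pqab s : oo p q s -> oo a b s.
    by move=> /andP[? ?]; apply/andP; split; lra.
  apply: (connected_sub_arc hX ak _ cm ud _ _ muw kw).
  - exact: (arc_connected ah).
  - by move=> [s /pqab abs hs]; apply: kmU; exists s.
  - move=> [s pqs]; rewrite kuht => /hI st; have /eqP := pqt _ pqs; apply.
    by apply: st; [exact: pqab|apply/andP].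
have sideb := side t b (ltW at_) (lexx b).
have sidea := side a t (lexx a) (ltW tb).
have dec w : oo m d w -> w != u -> (h @` oo t b) (k w) \/ (h @` oo a t) (k w).
  move=> mdw wu; have [s /andP[as_ sb] hs] : (h @` oo a b) (k w).
    by apply: kU; exists w.
  have [st|ts|st] := ltgtP s t.
  - by right; exists s => //; apply/andP; split.
  - by left; exists s => //; apply/andP; split.
  - move/eqP : wu; case; apply: kI; last by rewrite kuht -hs st.
      move: mdw => /andP[? ?]; apply/andP; split; lra.
    by apply/andP; split; lra.
(* The parameter [w] is beyond [u], yet [k w] is on one of the sides; if both sides were in the
   image of [oo m u], injectivity of [k] would fail. *)
have nboth : h @` oo t b `<=` k @` oo m u -> h @` oo a t `<=` k @` oo m u ->
    False.
  move=> Sb Sa; pose w := (u + d) / 2.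
  have [w' /andP[mw' w'u]] : (k @` oo m u) (k w).
    have [||/Sb//|/Sa//] := dec w; first by apply/andP; rewrite /w; split; lra.
    by rewrite gt_eqF // /w; lra.
  move=> /kI kww; have : w' = w.
    by apply: kww; apply/andP; rewrite /w; split; lra.
  by rewrite /w; lra.
have side_eq (p q : R) : h @` oo p q `<=` k @` oo m u ->
    (forall w, oo m u w -> (h @` oo p q) (k w)) -> k @` oo m u = h @` oo p q.
  by move=> S1 S2; apply/seteqP; split=> // _ [w mw <-]; exact: S2.
have decu w : oo m u w -> (h @` oo t b) (k w) \/ (h @` oo a t) (k w).
  move=> /andP[mw wu]; apply: dec; last by rewrite lt_eqF.
  by apply/andP; split; lra.
have sideb' w muw := sideb _ w muw.
have sidea' w muw := sidea _ w muw.
have tgt s : oo t b s -> s != t by move=> /andP[ts _]; rewrite gt_eqF.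
have tlt s : oo a t s -> s != t by move=> /andP[_ ts]; rewrite lt_eqF.
have mu2 : oo m u ((m + u) / 2) by apply/andP; split; lra.
have [k1|k1] := decu _ mu2.
  have Sb := sideb tgt _ mu2 k1.
  left; apply: side_eq => // w mw; have [//|k2] := decu w mw.
  by have := nboth Sb (sidea tlt _ mw k2).
have Sa := sidea tlt _ mu2 k1.
right; apply: side_eq => // w mw; have [k2|//] := decu w mw.
by have := nboth (sideb tgt _ mw k2) Sa.
Qed.

(** The side cannot switch as the point moves from [u] towards [m]: the other side of [s] would
    contain a point of [h] before [t], hence outside the image of [oo m u]. *)
Lemma arc_end_side_right a b c d m h k u t v s :
  is_arc a b h -> is_arc c d k -> c < m ->
  k @` oo m d `<=` h @` oo a b -> ~ (h @` oo a b) (k m) ->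
  oo m d u -> oo a b t -> k u = h t -> k @` oo m u = h @` oo t b ->
  oo m u v -> oo a b s -> k v = h s ->
  k @` oo m v = h @` oo s b /\ t < s.
Proof.
move=> ah ak cm kU kmU mdu abt kuht kmu muv abs kvhs.
have [ab hI _] := ah.
have ts : t < s.
  have : (k @` oo m u) (k v) by exists v.
  rewrite kmu kvhs => -[r /andP[tr rb] /hI rs].
  rewrite -rs //; move: abt => /andP[? ?]; apply/andP; split; lra.
split=> //.
have mdv : oo m d v by move: muv mdu => /andP[? ?] /andP[? ?]; apply/andP; split; lra.
have [//|E] := arc_end_sides ah ak cm kU kmU mdv abs kvhs.
exfalso; pose r := (a + t) / 2.
move: (abt) (abs) => /andP[at_ tb] /andP[as_ sb].
have : (h @` oo a s) (h r) by exists r => //; apply/andP; rewrite /r; split; lra.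
rewrite -E => -[w /andP[mw wv] kw].
have : (k @` oo m u) (h r).
  by exists w => //; move: muv => /andP[? ?]; apply/andP; split; lra.
rewrite kmu => -[q /andP[tq qb] /hI qr].
have : q = r by apply: qr; apply/andP; rewrite /r; split; lra.
rewrite /r; lra.
Qed.

Lemma arc_end_sides_left a b c d m h k u t :
  is_arc a b h -> is_arc c d k -> m < d ->
  k @` oo c m `<=` h @` oo a b -> ~ (h @` oo a b) (k m) ->
  oo c m u -> oo a b t -> k u = h t ->
  k @` oo u m = h @` oo t b \/ k @` oo u m = h @` oo a t.
Proof.
move=> ah ak md kU kmU /andP[cu um] abt kuht.
have := @arc_end_sides a b (- d) (- c) (- m) h (k \o -%R) (- u) t ah
  (is_arc_opp ak).
rewrite !oo_opp_image /= !opprK; apply=> //; first by lra.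
by apply/andP; split; lra.
Qed.

End ArcEnds.

(** * Gluing two arcs along an overlap *)

Definition arc_join (R : realType) (X : Type) (h k : R -> X) (t0 u0 t : R) : X :=
  if t <= t0 then h t else k (t0 + u0 - t).

Section ArcJoin.
Context {R : realType} {X : topologicalType}.
Hypothesis hX : hausdorff_space X.
Implicit Types (a b c d e m u t v s : R) (h k : R -> X).

(** Beyond [t0] the arc [h] covers the same points as [k] between [m] and [u0]. The joined map
    therefore follows [h] up to [t0] and then [k] backwards from [u0], through [k m] and on towards
    [e], where it stays outside the image of [h]. Only at [t0] do both pieces enter the comparison
    of neighbourhoods. *)
Lemma is_arc_join a b c d m e h k u0 t0 :
  is_arc a b h -> is_arc c d k -> c < m ->
  k @` oo m d `<=` h @` oo a b -> ~ (h @` oo a b) (k m) ->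
  oo m d u0 -> oo a b t0 -> k u0 = h t0 -> k @` oo m u0 = h @` oo t0 b ->
  c <= e <= m -> (forall u, e < u <= m -> ~ (h @` oo a b) (k u)) ->
  is_arc a (t0 + u0 - e) (arc_join h k t0 u0).
Proof.
move=> ah ak cm kU kmU mdu abt kuht kmu /andP[ce em] eU.
move: (mdu) (abt) => /andP[mu ud] /andP[at_ tb].
have [ab hI hN] := ah; have [cd kI kN] := ak.
(* A value common to both pieces, at a parameter of [k] above [m], would belong to the part of [h]
   beyond [t0], against injectivity of [h]; at a parameter up to [m] it contradicts [eU]. *)
have mixed s t : a < s -> s <= t0 -> t0 < t -> t < t0 + u0 - e ->
    h s = k (t0 + u0 - t) -> False.
  move=> as_ st0 t0t tb' hk.
  have [ut|tu] := ltP m (t0 + u0 - t).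
    have : (k @` oo m u0) (h s).
      by exists (t0 + u0 - t) => //; apply/andP; split; lra.
    rewrite kmu => -[r /andP[t0r rb] /hI rs].
    have : r = s by apply: rs; apply/andP; split; lra.
    lra.
  apply: (eU (t0 + u0 - t)); first by apply/andP; split; lra.
  by exists s => //; apply/andP; split; lra.
have E1 t : t <= t0 -> arc_join h k t0 u0 t = h t by rewrite /arc_join => ->.
have E2 t : t0 < t -> arc_join h k t0 u0 t = k (t0 + u0 - t).
  by rewrite /arc_join leNgt => ->.
have E2' t : t0 <= t -> arc_join h k t0 u0 t = k (t0 + u0 - t).
  rewrite le_eqVlt => /orP[/eqP <-|/E2 //].
  by rewrite E1 // -kuht; congr k; lra.
split; first by lra.
  move=> s t /andP[as_ sb'] /andP[at' tb'].
  have [st0|t0s] := leP s t0; have [tt0|t0t] := leP t t0.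
  - by rewrite !E1 // => /hI; apply; apply/andP; split; lra.
  - by rewrite E1 // E2 // => /mixed []; lra.
  - by rewrite E2 // E1 // => /esym /mixed []; lra.
  - rewrite !E2 // => /kI H; suff : t0 + u0 - s = t0 + u0 - t by lra.
    by apply: H; apply/andP; split; lra.
move=> t /andP[at' tb'] A.
have [tt0|t0t|tt0] := ltgtP t t0.
- have nE : \forall s \near t, arc_join h k t0 u0 s = h s.
    have := nbhs_oo (a := a) (b := t0) (t := t); rewrite /oo /= at' tt0 => /(_ isT).
    by apply: filterS => s /andP[_ /ltW]; exact: E1.
  rewrite E1 ?ltW // (hN t) /oo /= ?at' ?(lt_trans tt0) //.
  by split; apply: filterS2 nE => s /= ->.
- have nE : \forall s \near t, arc_join h k t0 u0 s = k (t0 + u0 - s).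
    have := nbhs_oo (a := t0) (b := t0 + u0 - e) (t := t).
    rewrite /oo /= tb' t0t => /(_ isT).
    by apply: filterS => s /andP[/E2].
  rewrite E2 // (kN (t0 + u0 - t)); last by apply/andP; split; lra.
  split=> [/nbhs_reflect|]; first by apply: filterS2 nE => s /= ->.
  move=> nA; have /nbhs_reflect : nbhs (t0 + u0 - (t0 + u0 - t))
      (arc_join h k t0 u0 @^-1` A `&` [set s | arc_join h k t0 u0 s = k (t0 + u0 - s)]).
    by rewrite subKr; exact: filterI.
  by apply: filterS => s /= [+ Es]; rewrite Es subKr.
- rewrite tt0 E1 //; split=> [hA|/nbhs_ex_oo[r r0 rA]].
    have kA : nbhs t0 [set s | A (k (t0 + u0 - s))].
      apply: (@nbhs_reflect _ (t0 + u0) t0 (k @^-1` A)).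
      rewrite [t0 + u0]addrC addrK; apply/(kN u0); last by rewrite kuht.
      by apply/andP; split; lra.
    move/(hN _ abt) : hA => hA.
    apply: filterS2 hA kA => s /= hs ks.
    by have [/E1 ->|/E2 ->] := leP s t0.
  (* The parameter [v] is in [oo m u0] and within [r] of [u0], so [A] holds along [k] between [v]
     and [u0]. By [arc_end_side_right] this stretch contains all values of [h] between [t0] and [s],
     which gives a neighbourhood of [t0] on which [h] takes values in [A]. *)
  pose v := Num.max ((m + u0) / 2) (u0 - r / 2).
  have [v1 v2 v3] : [/\ (m + u0) / 2 <= v, u0 - r / 2 <= v & v < u0].
    by rewrite /v !le_max !lexx orbT gt_max; split=> //; apply/andP; split; lra.
  have muv : oo m u0 v by apply/andP; split; lra.
  have [s abs kvhs] : (h @` oo a b) (k v).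
    by apply: kU; exists v => //; apply/andP; split; lra.
  have [kmv t0s] := arc_end_side_right hX ah ak cm kU kmU mdu abt kuht kmu muv abs
    (esym kvhs).
  apply/(hN t0 abt).
  pose p := Num.max a (t0 - r).
  have [p1 p2 p3] : [/\ a <= p, t0 - r <= p & p < t0].
    by rewrite /p !le_max !lexx orbT gt_max at_ /=; split=> //; lra.
  apply: filterS (_ : nbhs t0 (oo p s)); last by apply: nbhs_oo; rewrite /oo /= p3.
  move=> w /andP[pw ws] /=.
  have [wt0|t0w] := leP w t0.
    have : A (arc_join h k t0 u0 w) by apply: rA; apply/andP; split; lra.
    by rewrite E1.
  have : (h @` oo t0 b) (h w).
    exists w => //; move: abs => /andP[? ?]; apply/andP; split; lra.
  rewrite -kmu => -[u /andP[mu' uu0] kuhw].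
  have [vu|uv] := leP v u.
    have : A (arc_join h k t0 u0 (t0 + u0 - u)).
      by apply: rA; apply/andP; split; lra.
    by rewrite E2' ?subKr ?kuhw //; lra.
  have : (k @` oo m v) (h w) by exists u => //; apply/andP.
  rewrite kmv => -[q /andP[sq qb] /hI qw].
  have : q = w by apply: qw; move: abs => /andP[? ?]; apply/andP; split; lra.
  lra.
Qed.

(** Nothing is lost by the cut: the part of [h] beyond [t0] is the image under [k] of [oo m u0], and
    the part of [k] from [u0] on lies in the image of [h]. *)
Lemma arc_join_image a b c d m e h k u0 t0 :
  c < m -> k @` oo m d `<=` h @` oo a b ->
  oo m d u0 -> oo a b t0 -> k u0 = h t0 -> k @` oo m u0 = h @` oo t0 b ->
  c <= e <= m ->
  arc_join h k t0 u0 @` oo a (t0 + u0 - e) = h @` oo a b `|` k @` oo e d.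
Proof.
move=> cm kU mdu abt kuht kmu /andP[ce em].
move: (mdu) (abt) => /andP[mu ud] /andP[at_ tb].
have E1 t : t <= t0 -> arc_join h k t0 u0 t = h t by rewrite /arc_join => ->.
have E2 t : t0 < t -> arc_join h k t0 u0 t = k (t0 + u0 - t).
  by rewrite /arc_join leNgt => ->.
have sub u : e < u -> u < u0 ->
    (arc_join h k t0 u0 @` oo a (t0 + u0 - e)) (k u).
  move=> eu uu0; exists (t0 + u0 - u); first by apply/andP; split; lra.
  by rewrite E2 ?subKr //; lra.
have subh : h @` oo a b `<=` arc_join h k t0 u0 @` oo a (t0 + u0 - e).
  move=> _ [t /andP[at' tb'] <-].
  have [tt0|t0t] := leP t t0.
    by exists t; rewrite ?E1 //; apply/andP; split; lra.
  have : (h @` oo t0 b) (h t) by exists t => //; apply/andP.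
  by rewrite -kmu => -[u /andP[mu' uu0] <-]; apply: sub => //; lra.
apply/seteqP; split.
  move=> _ [t /andP[at' tb'] <-]; have [tt0|t0t] := leP t t0.
    by left; rewrite E1 //; exists t => //; apply/andP; split; lra.
  by right; rewrite E2 //; exists (t0 + u0 - t) => //; apply/andP; split; lra.
move=> x [/subh //|[u /andP[eu ud'] <-]].
have [|u0u] := ltP u u0; first exact: sub.
apply: subh; apply: kU; exists u => //; apply/andP; split; lra.
Qed.

End ArcJoin.

(** * Simple closed curves and the union of two overlapping arcs *)

Definition is_arcset (R : realType) (X : topologicalType) (U : set X) : Prop :=
  exists (a b : R) (h : R -> X), is_arc a b h /\ h @` oo a b = U.

(** A simple closed curve. Injectivity is asked on a half-open range, so that the two ends are the
    only parameters identified. *)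
Definition is_loop (R : realType) (X : topologicalType) (C : set X) : Prop :=
  exists (a b : R) (f : R -> X),
    [/\ a < b, continuous f, f a = f b,
        forall s t, a < s <= b -> a < t <= b -> f s = f t -> s = t &
        f @` [set t | a <= t <= b] = C].

Section ArcUnion.
Context {R : realType} {X : topologicalType}.
Hypothesis hX : hausdorff_space X.
Implicit Types (a b c d e m u t v s : R) (h k : R -> X).

(** The last two hypotheses say that both ends of the arc converge to [p]. Extending [F] by the
    constant [p] outside [oo a b] then gives a map that is continuous on the whole line. *)
Lemma arc_close_loop a b (F : R -> X) (p : X) :
  is_arc a b F -> ~ (F @` oo a b) p ->
  (forall A, nbhs p A -> exists2 s, oo a b s & F @` oo a s `<=` A) ->
  (forall A, nbhs p A -> exists2 s, oo a b s & F @` oo s b `<=` A) ->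
  is_loop R (p |` F @` oo a b).
Proof.
move=> [ab FI FN] pF lim_a lim_b.
pose G t := if t <= a then p else if t < b then F t else p.
have Ga t : t <= a -> G t = p by rewrite /G => ->.
have Gb t : b <= t -> G t = p by rewrite /G [t < b]ltNge => ->; case: ifP.
have GF t : oo a b t -> G t = F t.
  by rewrite /G leNgt => /andP[at' tb]; rewrite at' tb.
exists a, b, G; split=> //.
- move=> t A; have [ta|at'] := ltP t a.
    rewrite Ga ?ltW // => nA; have nt : nbhs t (oo (t - 1) a).
      by apply: nbhs_oo; apply/andP; split; lra.
    apply: filterS nt => s /andP[_ sa]; rewrite /= Ga ?ltW //.
    exact: nbhs_singleton.
  have [bt|tb] := ltP b t.
    rewrite Gb ?ltW // => nA; have nt : nbhs t (oo b (t + 1)).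
      by apply: nbhs_oo; apply/andP; split; lra.
    apply: filterS nt => s /andP[bs _]; rewrite /= Gb ?ltW //.
    exact: nbhs_singleton.
  have [->|ta] := eqVneq t a.
    rewrite Ga // => nA; have [s /andP[as_ sb] sA] := lim_a A nA.
    have na : nbhs a (oo (a - 1) s) by apply: nbhs_oo; apply/andP; split; lra.
    apply: filterS na => w /andP[_ ws] /=; have [wa|aw] := leP w a.
      by rewrite Ga //; exact: nbhs_singleton.
    by rewrite GF; [apply: sA; exists w => //|]; apply/andP; split; lra.
  have [->|tb'] := eqVneq t b.
    rewrite Gb // => nA; have [s /andP[as_ sb] sA] := lim_b A nA.
    have nb : nbhs b (oo s (b + 1)) by apply: nbhs_oo; apply/andP; split; lra.
    apply: filterS nb => w /andP[sw _] /=; have [bw|wb] := leP b w.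
      by rewrite Gb //; exact: nbhs_singleton.
    by rewrite GF; [apply: sA; exists w => //|]; apply/andP; split; lra.
  have abt : oo a b t by rewrite /oo /= !lt_neqAle at' tb tb' eq_sym ta.
  rewrite GF // => /(FN _ abt); apply: filterS2 (nbhs_oo abt) => s abs.
  by rewrite /= GF.
- by rewrite Ga // Gb.
- move=> s t /andP[as_ sb] /andP[at' tb].
  have [->|sb'] := eqVneq s b; have [->|tb'] := eqVneq t b => //.
  + have abt : oo a b t by rewrite /oo /= at' lt_neqAle tb' tb.
    by rewrite Gb // GF // => pE; case: pF; exists t.
  + have abs : oo a b s by rewrite /oo /= as_ lt_neqAle sb' sb.
    by rewrite GF // Gb // => pE; case: pF; exists s.
  + have abt : oo a b t by rewrite /oo /= at' lt_neqAle tb' tb.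
    have abs : oo a b s by rewrite /oo /= as_ lt_neqAle sb' sb.
    by rewrite !GF //; exact: FI.
- apply/seteqP; split=> [_ [t /andP[at' tb] <-]|x [->|[t abt <-]]].
  + have [ta|ta] := leP t a; first by rewrite Ga //; left.
    have [bt|tb'] := leP b t; first by rewrite Gb //; left.
    by rewrite GF; [right; exists t => //|]; apply/andP.
  + by exists a; rewrite /= ?lexx ?(ltW ab) // Ga.
  + by exists t; [move: abt => /andP[? ?]; rewrite /= !ltW|rewrite GF].
Qed.

(* [h] leaves through [k m] at [b].  Left of [m], the points of [V] in [U] form
   an initial segment of [V]: if it is empty the arcs glue to an arc, and if it
   ends at [e] then [h] also leaves through [k e] at [a], and the glued arc closes
   up at [k e]. *)
Lemma arc_union_overlap a b c d m h k u0 t0 :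
  is_arc a b h -> is_arc c d k -> c < m ->
  k @` oo m d `<=` h @` oo a b -> ~ (h @` oo a b) (k m) ->
  oo m d u0 -> oo a b t0 -> k u0 = h t0 -> k @` oo m u0 = h @` oo t0 b ->
  ~ h @` oo a b `<=` k @` oo c d ->
  is_arcset R (h @` oo a b `|` k @` oo c d) \/
  is_loop R (h @` oo a b `|` k @` oo c d).
Proof.
move=> ah ak cm kU kmU mdu abt kuht kmu nUV.
move: (mdu) (abt) => /andP[mu ud] /andP[at_ tb].
have [ab hI hN] := ah; have [cd kI kN] := ak.
pose U := h @` oo a b.
pose D := [set u | c < u < m /\ U (k u)].
(* [D] is an initial segment of [oo c m]: if [k w] were outside [U], then [k w] and [k m] would
   enclose the connected set [U] between them, inside the image of [k]. *)
have down u w : D u -> c < w -> w < u -> U (k w).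
  move=> [/andP[cu um] Uu] cw wu; apply: contrapT => nUw; apply: nUV.
  have wmu : oo w m u by apply/andP; split; lra.
  have md : m < d by lra.
  have := connected_sub_arc hX ak (arc_connected ah (lexx a) (lexx b)) cw md
    nUw kmU wmu Uu.
  move=> /subset_trans; apply=> _ [v /andP[wv vm] <-]; exists v => //.
  by apply/andP; split; lra.
have [D0|/forallNP D0] := pselect (D !=set0); last first.
  left; exists a, (t0 + u0 - c), (arc_join h k t0 u0).
  have ccm : c <= c <= m by rewrite lexx ltW.
  split; last exact: arc_join_image mdu abt kuht kmu ccm.
  apply: (is_arc_join hX ah ak cm kU kmU mdu abt kuht kmu ccm).
  move=> u /andP[cu]; rewrite le_eqVlt => /orP[/eqP -> //|um Uu].
  by apply: (D0 u); split=> //; apply/andP.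
have supD : has_sup D by split=> //; exists m => u [/andP[_ /ltW]].
pose e := sup D.
have De u : D u -> u <= e by move=> Du; apply: sup_upper_bound.
have ce : c < e.
  by have [u Du] := D0; have := De _ Du; case: Du => /andP[? ?] _ ?; lra.
have em : e <= m by apply: ge_sup => // u [/andP[_ /ltW]].
have keL w : c < w -> w < e -> U (k w).
  move=> cw we; have ew0 : 0 < e - w by lra.
  have [u Du] := sup_adherent ew0 supD; rewrite -/e => uw.
  by apply: (down u) => //; lra.
have keR u : e < u <= m -> ~ U (k u).
  move=> /andP[eu]; rewrite le_eqVlt => /orP[/eqP -> //|um Uu].
  have : D u by split=> //; apply/andP; split; lra.
  by move=> /De; lra.
have ked : oo c d e by apply/andP; split; lra.
(* For [e < m], the open set [U] around [k e] would also contain [k u] for some [u] just above [e],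
   against [keR]. *)
have ke : ~ U (k e).
  have [->//|em' Ue] := eqVneq e m.
  have em2 : e < m by rewrite lt_neqAle em' em.
  have /(kN e ked) /nbhs_ex_oo[r r0 rU] : nbhs (k e) U.
    by apply: open_nbhs_nbhs; split=> //; exact: (arc_open ah).
  pose u := Num.min (e + r / 2) ((e + m) / 2).
  have [u1 u2 u3] : [/\ u <= e + r / 2, u <= (e + m) / 2 & e < u].
    by rewrite /u !ge_min !lexx orbT lt_min; split=> //; apply/andP; split; lra.
  apply: (keR u); first by apply/andP; split; lra.
  by apply: rU; apply/andP; split; lra.
have cem : c <= e <= m by apply/andP; split; lra.
have aF := is_arc_join hX ah ak cm kU kmU mdu abt kuht kmu cem keR.
have F_im := arc_join_image cm kU mdu abt kuht kmu cem.
pose F := arc_join h k t0 u0; pose b' := t0 + u0 - e; pose p := k e.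
have [ab' FI FN] := aF; rewrite -/F -/b' in F_im ab' FI FN aF.
have Fk t : t0 < t -> F t = k (t0 + u0 - t).
  by rewrite /F /arc_join leNgt => ->.
have Fh t : t <= t0 -> F t = h t by rewrite /F /arc_join => ->.
have e_u0 : e < u0 by apply: le_lt_trans em mu.
have t0b' : t0 < b' by rewrite /b' -addrA ltrDl subr_gt0.
have lim_a A : nbhs p A -> exists2 s, oo a b s & h @` oo a s `<=` A.
  move=> /(kN e ked) /nbhs_ex_oo[r r0 rA].
  pose v := Num.max ((c + e) / 2) (e - r / 2).
  have [v1 v2 v3] : [/\ (c + e) / 2 <= v, e - r / 2 <= v & v < e].
    by rewrite /v !le_max !lexx orbT gt_max; split=> //; apply/andP; split; lra.
  have [s abs hskv] : U (k v) by apply: keL; lra.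
  have sub : k @` oo c e `<=` h @` oo a b.
    by move=> _ [w /andP[cw we] <-]; exact: keL.
  exists s => //; have ed : e < d by move: ked => /andP[].
  have cev : oo c e v by apply/andP; split; lra.
  move: (abs) => /andP[as_ sb].
  have [E|<-] := arc_end_sides_left hX ah ak ed sub ke cev abs (esym hskv).
    (* The end [b] of [h] is excluded: [q] is beyond both [s] and [t0], so [h q] would be a value of
       [k] at a parameter below [e] and also at one above [m]. *)
    pose q := Num.max ((s + b) / 2) ((t0 + b) / 2).
    have [q1 q2 q3] : [/\ (s + b) / 2 <= q, (t0 + b) / 2 <= q & q < b].
      by rewrite /q !le_max !lexx orbT gt_max; split=> //; apply/andP; split; lra.
    have : (h @` oo t0 b) (h q) by exists q => //; apply/andP; split; lra.
    have : (h @` oo s b) (h q) by exists q => //; apply/andP; split; lra.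
    rewrite -E -kmu => -[x /andP[vx xe] <-] [y /andP[my yu] /kI xy].
    have : y = x by apply: xy; apply/andP; split; lra.
    lra.
  by move=> _ [w /andP[vw we] <-]; apply: rA; apply/andP; split; lra.
right; have -> : h @` oo a b `|` k @` oo c d = p |` F @` oo a b'.
  rewrite F_im; apply/seteqP; split=> x.
    move=> [Ux|[u /andP[cu ud'] <-]]; first by right; left.
    have [ue|eu|->] := ltgtP u e; last by left.
      by right; left; exact: keL.
    by right; right; exists u => //; apply/andP.
  move=> [->|[Ux|[u /andP[eu ud'] <-]]]; [by right; exists e|by left|right].
  by exists u => //; apply/andP; split => //; exact: lt_trans eu.
apply: arc_close_loop aF _ _ _.
- rewrite F_im => -[//|[w /andP[ew wd] /kI we]].
  suff : w = e by lra.
  by apply: we => //; apply/andP; split; lra.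
- move=> A nA; have [s /andP[as_ sb] sA] := lim_a A nA.
  pose q := Num.min s t0.
  have [q1 q2 q3] : [/\ q <= s, q <= t0 & a < q].
    by rewrite /q !ge_min !lexx orbT lt_min; split=> //; apply/andP.
  exists q; first by rewrite /oo /= q3 (le_lt_trans q2 t0b').
  move=> _ [w /andP[aw wq] <-]; rewrite Fh; last exact: ltW (lt_le_trans wq q2).
  by apply: sA; exists w => //; rewrite /oo /= aw (lt_le_trans wq q1).
- move=> A /(kN e ked) /nbhs_ex_oo[r r0 rA].
  pose q := Num.max t0 (b' - r).
  have [q1 q2 q3] : [/\ t0 <= q, b' - r <= q & q < b'].
    by rewrite /q !le_max !lexx orbT gt_max t0b' /= gtrBl.
  exists q; first by rewrite /oo /= q3 (lt_le_trans at_ q1).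
  move=> _ [w /andP[qw wb] <-]; rewrite Fk; last exact: le_lt_trans q1 qw.
  clear - r0 rA q2 qw wb; rewrite /b' in q2 wb.
  by apply: rA; apply/andP; split; lra.
Qed.

End ArcUnion.

(** * From a finite cover by arcs to loops *)

Lemma count_lt (T : eqType) (p q : pred T) (s : seq T) x :
  subpred p q -> x \in s -> ~~ p x -> q x -> (count p s < count q s)%N.
Proof.
move=> pq + npx qx; elim: s => //= y s IH; rewrite inE => /predU1P[<-|/IH lt].
  by rewrite (negbTE npx) qx ltnS sub_count.
by rewrite -addnS leq_add //; case: (p y) (pq y) => // ->.
Qed.

Section ArcLoops.
Context {R : realType} {X : topologicalType}.
Hypothesis hX : hausdorff_space X.
Implicit Types (a b c d e m u t v s : R) (h k : R -> X) (U V W C M : set X).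

(** By [arc_end_sides] the overlap is one of the two ends of [h]; reversing [h] if necessary makes
    it the end [b]. *)
Lemma arc_union_right a b c d m h k :
  is_arc a b h -> is_arc c d k -> c < m < d ->
  k @` oo m d `<=` h @` oo a b -> ~ (h @` oo a b) (k m) ->
  ~ h @` oo a b `<=` k @` oo c d ->
  is_arcset R (h @` oo a b `|` k @` oo c d) \/
  is_loop R (h @` oo a b `|` k @` oo c d).
Proof.
move=> ah ak /andP[cm md] kU kmU nUV.
pose u := (m + d) / 2.
have mdu : oo m d u by apply/andP; rewrite /u; split; lra.
have [t abt htku] : (h @` oo a b) (k u) by apply: kU; exists u.
have [E|E] := arc_end_sides hX ah ak cm kU kmU mdu abt (esym htku).
  exact: (arc_union_overlap hX ah ak cm kU kmU mdu abt (esym htku) E nUV).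
have := @arc_union_overlap _ _ hX (- b) (- a) c d m (h \o -%R) k u (- t)
  (is_arc_opp ah) ak cm.
rewrite !oo_opp_image /= opprK; apply=> //.
by move: abt => /andP[? ?]; apply/andP; split; lra.
Qed.

(** One of the two sides of [m] in the second arc lies in the first arc, which is the situation of
    [arc_union_right]. Otherwise there are [w < m < v] with [k w] and [k v] outside the first arc.
    By connectedness the first arc then misses the whole stretch between them, which is a
    neighbourhood of its closure point [k m]. *)
Lemma arc_union a b c d m h k :
  is_arc a b h -> is_arc c d k -> oo c d m ->
  closure (h @` oo a b) (k m) -> ~ (h @` oo a b) (k m) ->
  ~ h @` oo a b `<=` k @` oo c d ->
  is_arcset R (h @` oo a b `|` k @` oo c d) \/
  is_loop R (h @` oo a b `|` k @` oo c d).
Proof.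
move=> ah ak cdm kmcl kmU nUV; move: (cdm) => /andP[cm md].
have cU := arc_connected ah (lexx a) (lexx b).
have [kU|nR] := pselect (k @` oo m d `<=` h @` oo a b).
  by apply: (arc_union_right ah ak _ kU).
have [kU|nL] := pselect (k @` oo c m `<=` h @` oo a b).
  have := @arc_union_right a b (- d) (- c) (- m) h (k \o -%R) ah (is_arc_opp ak).
  rewrite !oo_opp_image /= opprK; apply=> //.
  by apply/andP; split; lra.
have [v /andP[mv vd] nUv] : exists2 v, oo m d v & ~ (h @` oo a b) (k v).
  apply: contrapT => N; apply: nR => _ [v mdv <-].
  by apply: contrapT => nUv; apply: N; exists v.
have [w /andP[cw wm] nUw] : exists2 w, oo c m w & ~ (h @` oo a b) (k w).
  apply: contrapT => N; apply: nL => _ [w cmw <-].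
  by apply: contrapT => nUw; apply: N; exists w.
have sub p q : c < p -> q < d -> ~ (h @` oo a b) (k p) -> ~ (h @` oo a b) (k q) ->
    forall s, oo p q s -> ~ (h @` oo a b) (k s).
  move=> cp qd nUp nUq s pqs Us; apply: nUV.
  have := connected_sub_arc hX ak cU cp qd nUp nUq pqs Us.
  move=> /subset_trans; apply=> _ [r /andP[pr rq] <-]; exists r => //.
  by apply/andP; split; lra.
have wvm : oo w v m by apply/andP.
have [x [Ux [s /andP[ws sv] ksx]]] := kmcl _ (arc_image_nbhs ak cdm (nbhs_oo wvm)).
have [sm|ms|sm] := ltgtP s m; exfalso.
- by apply: (sub w m cw md nUw kmU s); rewrite ?ksx //; apply/andP.
- by apply: (sub m v cm vd kmU nUv s); rewrite ?ksx //; apply/andP.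
- by apply: kmU; rewrite -sm ksx.
Qed.

Lemma is_arcset_open U : is_arcset R U -> open U.
Proof. by move=> [a [b [h [ah <-]]]]; exact: (arc_open ah). Qed.

(** Otherwise the arc would be compact, and [h] would have a cluster point [h t] in it as the
    parameter tends to [b]. But for [t < r < b] the image of [oo a r] is a neighbourhood of [h t]
    that avoids all values of [h] between [r] and [b]. *)
Lemma arcset_not_closed U M : is_arcset R U -> compact M -> U `<=` M ->
  exists2 p, closure U p & ~ U p.
Proof.
move=> [a [b [h [ah <-]]]] cM UM; have [ab hI hN] := ah.
apply: contrapT => N.
have cU : compact (h @` oo a b).
  rewrite -(setIidr UM); apply: compact_closedI => // p clp.
  by apply: contrapT => nUp; apply: N; exists p.
have bnear s : s < b -> \forall t \near b^'-, s < t < b.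
  move=> sb; near=> t; apply/andP; split; near: t.
    exact: nbhs_left_gt.
  exact: nbhs_left_lt.
have [|_ [[t abt <-] cl]] := cU (h @ b^'-) _.
  by apply: filterS (bnear a ab) => t abt; exists t.
move: (abt) => /andP[at_ tb].
pose r := (t + b) / 2.
have tb2 : oo a r t by apply/andP; rewrite /r; split; lra.
have [|_ [[s /andP[rs sb] <-] [q /andP[aq qr] /hI qs]]] :=
    cl (h @` oo r b) _ _ (arc_image_nbhs ah abt (nbhs_oo tb2)).
  have rb : r < b by rewrite /r; lra.
  by apply: filterS (bnear r rb) => s rsb; exists s.
have : q = s by apply: qs; apply/andP; rewrite /r in rs qr *; split; lra.
lra.
Unshelve. all: by end_near.
Qed.

Lemma arcset_sub_loop M (s : seq X) (V : X -> set X) U :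
  compact M -> (forall x, x \in s -> is_arcset R (V x) /\ V x `<=` M) ->
  (forall x, M x -> exists2 y, y \in s & V y x) ->
  is_arcset R U -> U `<=` M ->
  exists C, [/\ is_loop R C, open C, U `<=` C & C `<=` M].
Proof.
move=> cM sV Ms.
(* Induction on the number of arcs of the cover not contained in [U]. The added arc [V x] contains a
   boundary point [p] outside [U], so it was counted before and is no longer counted afterwards. *)
have [n] := ubnP (count (fun x => ~~ `[< V x `<=` U >]) s).
elim: n U => // n IH U /ltnSE nU aU UM.
have [p clp nUp] := arcset_not_closed aU cM UM.
have Mp : M p.
  by have /closure_id cl := compact_closed hX cM; rewrite cl; exact: closureS UM _ clp.
have [x xs Vxp] := Ms _ Mp; have [aV VM] := sV _ xs.
have next W : is_arcset R W -> W `<=` M -> U `<=` W -> V x `<=` W ->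
    exists C, [/\ is_loop R C, open C, U `<=` C & C `<=` M].
  move=> aW WM UW VW.
  have [|//|//|C [lC oC WC CM]] := IH W.
    apply: leq_trans nU; apply: (count_lt _ xs).
    - by move=> y; apply: contraNN => /asboolP VU; apply/asboolP => z /VU /UW.
    - by rewrite negbK; apply/asboolP.
    - by apply/asboolP => VU; apply: nUp; exact: VU.
  by exists C; split=> //; exact: subset_trans WC.
(* If [U] lies in [V x], then [V x] simply replaces [U]; otherwise [arc_union] applies at [p]. *)
have [UV|nUV] := pselect (U `<=` V x); first exact: (next (V x)).
have UVM : U `|` V x `<=` M by rewrite subUset.
have oUV : open (U `|` V x) by apply: openU; exact: is_arcset_open.
have [a [b [h [ah hU]]]] := aU; have [c [d [k [ak kV]]]] := aV.
move: (Vxp); rewrite -{1}kV => -[m cdm kmp].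
have := @arc_union a b c d m h k ah ak cdm.
rewrite hU kV kmp => /(_ clp nUp nUV) [aUV|lUV].
  exact: (next _ aUV UVM (@subsetUl _ U (V x)) (@subsetUr _ U (V x))).
by exists (U `|` V x); split=> //; left.
Qed.

End ArcLoops.

(** * Circles *)

Section Circle.
Context {R : realType}.

Lemma circle_fst_continuous : continuous (fun p : circle R => (set_val p).1).
Proof.
move=> p; apply: (@continuous_comp _ _ _ set_val fst); last exact: cvg_fst.
exact: initial_continuous.
Qed.

Lemma circle_snd_continuous : continuous (fun p : circle R => (set_val p).2).
Proof.
move=> p; apply: (@continuous_comp _ _ _ set_val snd); last exact: cvg_snd.
exact: initial_continuous.
Qed.

Lemma circleE (p : circle R) : (set_val p).1 ^+ 2 + (set_val p).2 ^+ 2 = 1.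
Proof. exact: (set_valP p). Qed.

Lemma unit_circle_bound (x y : R) : x ^+ 2 + y ^+ 2 = 1 ->
  -1 <= x <= 1 /\ (y < 0 -> -1 < x < 1).
Proof.
move=> h; rewrite -ler_norml -ltr_norml.
rewrite -[_ <= 1](ler_sqr (x := `|x|)) ?nnegrE //.
rewrite -[_ < 1](ltr_sqr (x := `|x|)) ?nnegrE // real_normK ?num_real // expr1n -h.
by rewrite lerDl ltrDl sqr_ge0; split=> // y0; rewrite exprn_even_gt0 //= lt_eqF.
Qed.

Lemma circle_compact : compact [set: circle R].
Proof.
apply: compact_set_type.
have box : compact (`[-1 : R, 1]%classic `*` `[-1 : R, 1]%classic).
  by apply: compact_setX; exact: segment_compact.
apply: (subclosed_compact _ box).
  have c2 : continuous (fun p : R * R => p.1 ^+ 2 + p.2 ^+ 2).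
    move=> p; apply: cvgD; rewrite !expr2.
      by apply: cvgM; exact: cvg_fst.
    by apply: cvgM; exact: cvg_snd.
  have := closed_comp (f := fun p : R * R => p.1 ^+ 2 + p.2 ^+ 2) (D := [set 1]).
  by apply; [move=> p _; exact: c2|exact: closed_eq].
move=> [x y] /= h; split; rewrite /= in_itv /=.
  by have [] := unit_circle_bound h.
by move: h; rewrite addrC => h; have [] := unit_circle_bound h.
Qed.

(* A parameter running from [-1] (excluded) to [1] around the circle,
   starting and ending at the point [(-1, 0)]. *)
Definition circle_param (p : circle R) : R :=
  if 0 <= (set_val p).2 then (1 - (set_val p).1) / 2
  else - ((1 - (set_val p).1) / 2).

Lemma circle_param_inj : injective circle_param.
Proof.
move=> p q; have := circleE p; have := circleE q; rewrite /circle_param.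
move=> hq hp E; apply: val_inj; move: hp hq E.
rewrite -!set_valE; move: (set_val p) (set_val q) => [x y] [z w] /=.
have [y0|y0] := leP 0 y; have [w0|w0] := leP 0 w => hp hq E.
- have xz : x = z by lra.
  subst z; congr (_, _); apply/eqP; rewrite -(eqrXn2 (n := 2)) //; apply/eqP; lra.
- exfalso; have [/andP[_ ?] _] := unit_circle_bound hp.
  by have [_ /(_ w0)/andP[_ ?]] := unit_circle_bound hq; lra.
- exfalso; have [/andP[_ ?] _] := unit_circle_bound hq.
  by have [_ /(_ y0)/andP[_ ?]] := unit_circle_bound hp; lra.
- have xz : x = z by lra.
  subst z; congr (_, _); apply: oppr_inj; apply/eqP.
  by rewrite -(eqrXn2 (n := 2)) ?sqrrN ?oppr_ge0 ?ltW //; apply/eqP; lra.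
Qed.

Lemma circle_param_bound p : -1 < circle_param p <= 1.
Proof.
have := circleE p; rewrite /circle_param; move: (set_val p) => [x y] /= h.
have [/andP[x1 x2] y1] := unit_circle_bound h.
by have [_|/y1/andP[y2 y3]] /= := leP 0 y; apply/andP; split; lra.
Qed.

Lemma circle_param_surj s : -1 < s <= 1 -> exists p, circle_param p = s.
Proof.
move=> /andP[s1 s2].
have mem x y : x ^+ 2 + y ^+ 2 = 1 ->
    exists p : circle R, set_val p = (x, y).
  move=> xy; have m : (x, y) \in [set p : R * R | p.1 ^+ 2 + p.2 ^+ 2 = 1].
    exact/mem_set.
  by exists (@exist _ _ (x, y) m); rewrite set_valE.
have [s0|s0] := leP 0 s.
  pose x := 1 - 2 * s; pose y := Num.sqrt (1 - x ^+ 2).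
  have [|p pE] := mem x y; rewrite ?sqr_sqrtr ?subrKC //.
    have -> : 1 - x ^+ 2 = 4 * (s * (1 - s)) by rewrite /x; ring.
    by rewrite mulr_ge0 ?mulr_ge0 // subr_ge0.
  by exists p; rewrite /circle_param pE /= sqrtr_ge0 /x; lra.
pose x := 1 + 2 * s; pose y := - Num.sqrt (1 - x ^+ 2).
(* Strictness places the point strictly below the axis, in the second branch of [circle_param]. *)
have x1 : 0 < 1 - x ^+ 2.
  have -> : 1 - x ^+ 2 = 4 * (- s * (1 + s)) by rewrite /x; ring.
  by rewrite !mulr_gt0 //; lra.
have [|p pE] := mem x y; first by rewrite sqrrN sqr_sqrtr ?subrKC // ltW.
by exists p; rewrite /circle_param pE /= /y oppr_ge0 leNgt sqrtr_gt0 x1 /x /=; lra.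
Qed.

(** The map is [f] after [circle_param], rescaled by [A] to run from [a] to [b]. The jump of
    [circle_param] at [(-1, 0)] is absorbed by [f a = f b]. *)
Lemma loop_circle (X : topologicalType) (C : set X) : is_loop R C ->
  exists g : circle R -> X, [/\ continuous g, injective g & range g = C].
Proof.
move=> [a [b [f [ab cf fab fI <-]]]].
pose A (s : R) := a + (b - a) * ((s + 1) / 2).
have Ab s : -1 < s <= 1 -> a < A s <= b.
  by rewrite /A => /andP[? ?]; apply/andP; split; nra.
exists (fun p => f (A (circle_param p))); split.
(* [g1] and [g2] extend the two branches of the map to the whole circle; each is [f] after an affine
   function of the first coordinate. *)
- pose g1 (p : circle R) := f (A ((1 - (set_val p).1) / 2)).
  pose g2 (p : circle R) := f (A (- ((1 - (set_val p).1) / 2))).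
  have aff (u v : R) : continuous (fun s => u + v * s).
    move=> s; apply: cvgD; first exact: cvg_cst.
    by apply: cvgM; [exact: cvg_cst|exact: cvg_id].
  have cg (u v : R) : continuous (fun p : circle R => f (u + v * (set_val p).1)).
    move=> p; apply: (@continuous_comp _ _ _ (fun p : circle R => (set_val p).1)
      (fun s => f (u + v * s))); first exact: circle_fst_continuous.
    by apply: (@continuous_comp _ _ _ (fun s => u + v * s) f); [exact: aff|exact: cf].
  have cg1 : continuous g1.
    rewrite (_ : g1 = fun p => f (a + (b - a) * (3 / 4) +
      - ((b - a) / 4) * (set_val p).1)); first exact: cg.
    by apply/funext => p; rewrite /g1 /A; congr f; field.
  have cg2 : continuous g2.
    rewrite (_ : g2 = fun p => f (a + (b - a) / 4 +
      (b - a) / 4 * (set_val p).1)); first exact: cg.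
    by apply/funext => p; rewrite /g2 /A; congr f; field.
  have gE p : f (A (circle_param p)) = if 0 <= (set_val p).2 then g1 p else g2 p.
    by rewrite /circle_param; case: ifP.
  (* At [(1, 0)] both branches have parameter [0]; at [(-1, 0)] they have parameters [1] and [-1],
     which [A] sends to [b] and [a]. *)
  have g12 p : (set_val p).2 = 0 -> g1 p = g2 p.
    move=> y0; have := circleE p; rewrite y0 expr0n addr0 => /eqP.
    rewrite sqrf_eq1 /g1 /g2 => /orP[] /eqP ->; first by rewrite subrr mul0r oppr0.
    have -> : A ((1 - -1) / 2) = b by rewrite /A; lra.
    by have -> : A (- ((1 - -1) / 2)) = a by rewrite /A; lra.
  move=> p B nB; have [y0|y0|y0] := ltgtP 0 (set_val p).2.
  + have /circle_snd_continuous : nbhs (set_val p).2 [set y : R | 0 < y].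
      by apply: open_nbhs_nbhs; split=> //; exact: open_gt.
    have : nbhs p (g1 @^-1` B) by apply: cg1; move: nB; rewrite gE (ltW y0).
    by apply: filterS2 => q /= + q0; rewrite gE (ltW q0).
  + have /circle_snd_continuous : nbhs (set_val p).2 [set y : R | y < 0].
      by apply: open_nbhs_nbhs; split=> //; exact: open_lt.
    have : nbhs p (g2 @^-1` B) by apply: cg2; move: nB; rewrite gE leNgt y0.
    by apply: filterS2 => q /= + q0; rewrite gE leNgt q0.
  + have n1 : nbhs p (g1 @^-1` B) by apply: cg1; move: nB; rewrite gE -y0 lexx.
    have n2 : nbhs p (g2 @^-1` B).
      by apply: cg2; move: nB; rewrite gE -y0 lexx g12.
    by apply: filterS2 n1 n2 => q /= q1 q2; rewrite gE; case: ifP.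
- move=> p q /fI E; apply: circle_param_inj.
  have AE : A (circle_param p) = A (circle_param q).
    by apply: E; apply: Ab; exact: circle_param_bound.
  have ba : b - a != 0 by rewrite subr_eq0 gt_eqF.
  by move/addrI/(mulfI ba): AE; lra.
- apply/seteqP; split=> [_ [p _ <-]|_ [t /andP[at_ tb] <-]].
    exists (A (circle_param p)) => //=.
    by have /andP[/ltW -> ->] := Ab _ (circle_param_bound p).
  (* The rescaled parameter never takes the value [a], so [t = a] is traded for [t = b]. *)
  wlog at' : t at_ tb / a < t.
    move=> H; have [->|ta] := eqVneq t a; last first.
      by apply: H => //; rewrite lt_neqAle eq_sym ta.
    by rewrite fab; apply: H; rewrite ?lexx ?ltW.
  pose s := 2 * ((t - a) / (b - a)) - 1.
  have ba : 0 < b - a by lra.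
  have sE : A s = t.
    by rewrite /A /s; field; rewrite gt_eqF.
  have [|p pE] := @circle_param_surj s.
    have : 0 < (t - a) / (b - a) <= 1.
      by rewrite divr_gt0 ?subr_gt0 //= ler_pdivrMr // mul1r lerB.
    by rewrite /s => /andP[? ?]; apply/andP; split; lra.
  by exists p => //; rewrite pE sE.
Qed.

End Circle.

(** * Disjoint unions of open loops *)

Section LoopUnion.
Context {R : realType} {X : topologicalType}.
Hypothesis hX : hausdorff_space X.
Implicit Types (C D M : set X).

Lemma loop_compact C : is_loop R C -> compact C.
Proof.
move=> [a [b [f [ab cf _ _ <-]]]]; rewrite -set_itvcc.
by apply: continuous_compact; [exact: continuous_subspaceT|exact: segment_compact].
Qed.

Lemma loop_connected C : is_loop R C -> connected C.
Proof.
move=> [a [b [f [ab cf _ _ <-]]]]; rewrite -set_itvcc.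
apply: connected_continuous_connected; last exact: continuous_subspaceT.
exact: segment_connected.
Qed.

(** [D] is compact, hence closed as well as open, and [C] is connected. *)
Lemma loop_open_subset C D : is_loop R C -> is_loop R D -> open D ->
  C `&` D !=set0 -> C `<=` D.
Proof.
move=> lC lD oD CD0; rewrite -(_ : C `&` D = C); first by move=> x [].
apply: (loop_connected lC) => //; first by exists D.
by exists D => //; exact: (compact_closed hX (loop_compact lD)).
Qed.

Lemma loops_disjoint (L : seq (set X)) :
  (forall i, (i < size L)%N -> is_loop R (nth set0 L i) /\ open (nth set0 L i)) ->
  exists L' : seq (set X), [/\
    forall i, (i < size L')%N ->
      exists2 j, (j < size L)%N & nth set0 L' i = nth set0 L j,
    forall i, (i < size L)%N ->
      exists2 j, (j < size L')%N & nth set0 L i = nth set0 L' j &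
    forall i j, (i < size L')%N -> (j < size L')%N ->
      nth set0 L' i `&` nth set0 L' j !=set0 -> i = j].
Proof.
elim: L => [_|C L IH CL]; first by exists [::].
have [i iL|L' [L'L LL' L'd]] := IH; first exact: (CL i.+1).
have [lC oC] := CL 0%N isT.
have [[i iL' Ci]|NC] := pselect
    (exists2 i, (i < size L')%N & nth set0 L' i `&` C !=set0).
  exists L'; split=> //.
    by move=> j /L'L [k kL ->]; exists k.+1.
  move=> [_|j]; last exact: LL'.
  exists i => //=; have [k kL E] := L'L i iL'; have [lD oD] := CL k.+1 kL.
  move: Ci; rewrite E /= => Ci; apply/seteqP; split.
    by apply: loop_open_subset => //; rewrite setIC.
  exact: loop_open_subset.
exists (C :: L'); split=> [[_|i /L'L[k kL E]]|[_|i /LL'[k kL E]]|].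
- by exists 0%N.
- by exists k.+1.
- by exists 0%N.
- by exists k.+1.
- move=> [|i] [|j] //= iL jL; last by move=> /L'd ->.
    by rewrite setIC => H; case: NC; exists j.
  by move=> H; case: NC; exists i.
Qed.

(** Parametrizations of finitely many disjoint loops covering [M] form a continuous bijection from a
    compact disjoint union of circles onto the Hausdorff space [M]. *)
Lemma loop_cover_union_of_circles M : compact M ->
  (forall x, M x -> exists C, [/\ is_loop R C, open C, C x & C `<=` M]) ->
  is_finite_union_of_circles R M.
Proof.
move=> cM Mloop.
pose V x := if pselect (M x) is left Mx then projT1 (cid (Mloop x Mx)) else set0.
have VP x : M x -> [/\ is_loop R (V x), open (V x), V x x & V x `<=` M].
  by rewrite /V; case: pselect => // Mx _; exact: projT2 (cid (Mloop x Mx)).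
have [|s sM Ms] := compact_finite_subcover (U := V) cM.
  by move=> x /VP [_ oV Vx _]; exact: open_nbhs_nbhs.
have [|L [LV VL Ld]] := @loops_disjoint (map V s).
  move=> i; rewrite size_map => iS; case: s sM iS {Ms} => // x0 s sM iS.
  by rewrite (nth_map x0) //; have [] := VP _ (sM _ (mem_nth x0 iS)).
have LP (i : 'I_(size L)) : is_loop R (nth set0 L i) /\ nth set0 L i `<=` M.
  have [j] := LV i (ltn_ord i); rewrite size_map => jS ->.
  case: s sM jS {Ms LV VL Ld} => // x0 s sM jS.
  by rewrite (nth_map x0) //; have [] := VP _ (sM _ (mem_nth x0 jS)).
pose g (i : 'I_(size L)) : circle R -> X := projT1 (cid (loop_circle (LP i).1)).
have gP i : [/\ continuous (g i), injective (g i) & range (g i) = nth set0 L i].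
  exact: projT2 (cid (loop_circle (LP i).1)).
have gM i p : g i p \in M.
  apply/mem_set; apply: (LP i).2; have [_ _ <-] := gP i; by exists p.
pose F (z : {i : 'I_(size L) & circle R}) : set_type M :=
  @exist _ _ (g (projT1 z) (projT2 z)) (gM _ _).
exists (size L); apply: homeomorphic_sym; exists F.
apply: compact_hausdorff_homeomorphism.
- apply: sigT_compact => [|_]; last exact: circle_compact.
  exact: finite_finset.
- exact: hausdorff_set_type.
- apply: continuous_comp_initial => -[i p] A /=.
  by have [cg _ _] := gP i; move=> /cg.
- move=> [i p] [j q] /(congr1 val) /= E.
  have [_ gI gi] := gP i; have [_ _ gj] := gP j.
  have ij : i = j.
    apply: val_inj; apply: Ld; rewrite ?ltn_ord //; exists (g i p).
    by rewrite -gi -gj; split; [exists p|rewrite E; exists q].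
  by subst j; rewrite (gI _ _ E).
- move=> [x xM]; have Mx := set_mem xM; have [y ys Vyx] := Ms _ Mx.
  have [|j jL E] := VL (index y s); first by rewrite size_map index_mem.
  pose j' := Ordinal jL.
  have [_ _ gj] := gP j'.
  have : range (g j') x.
    by rewrite gj /= -E (nth_map y) ?index_mem // nth_index.
  move=> [p _ px]; exists (existT _ j' p); exact/val_inj.
Qed.

End LoopUnion.

Lemma homeomorphic_trans (X Y Z : topologicalType) :
  homeomorphic X Y -> homeomorphic Y Z -> homeomorphic X Z.
Proof.
move=> [f [cf [f' [cf' fK f'K]]]] [g [cg [g' [cg' gK g'K]]]].
exists (g \o f); split.
  by move=> x; apply: continuous_comp; [exact: cf|exact: cg].
exists (f' \o g'); split; [|exact: can_comp|exact: can_comp].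
by move=> x; apply: continuous_comp; [exact: cg'|exact: cf'].
Qed.

(** * Cantor sets *)

Section CantorEmbedding.
Context {R : realType} {Y : topologicalType}.

(** [T] is [Y] with the pseudometric pulled back from the line by [F]. The identity from [Y] to [T]
    is a homeomorphism by compactness, so the characterization of the Cantor space among
    pseudometric spaces applies to [T]. *)
Lemma cantor_of_embedding (F : Y -> R) (y0 : Y) :
  compact [set: Y] -> continuous F -> injective F -> zero_dimensional Y ->
  (forall y : Y, ~ open [set y]) -> homeomorphic Y cantor_space.
Proof.
move=> cY cF FI zY perf.
pose T : pseudoPMetricType R :=
  HB.pack (initial_topology F) (isPointed.Build (initial_topology F) y0).
have cid : continuous (id : Y -> T).
  by apply: continuous_comp_initial.
have hT : hausdorff_space T.
  apply: (@injective_hausdorff T R F) => //; exact: initial_continuous.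
have cT : compact [set: T].
  rewrite (_ : [set: T] = (id : Y -> T) @` [set: Y]); last first.
    by apply/seteqP; split=> // x _; exists x.
  by apply: continuous_compact => //; exact: continuous_subspaceT.
have [_ [g [cg gK Kg]]] : homeomorphism (id : Y -> T).
  by apply: compact_hausdorff_homeomorphism => // y; exists y.
have oT (A : set Y) : @open Y A -> @open T A.
  move=> oA; rewrite (_ : A = g @^-1` A); last first.
    by apply/funext => x; rewrite /preimage /= (Kg x : g x = x).
  by move/continuousP: cg; apply.
have clT (A : set Y) : @closed Y A -> @closed T A.
  by move=> cA; rewrite -[A]setCK; apply: open_closedC; apply: oT; exact: closed_openC.
have TY (A : set Y) : @open T A -> @open Y A.
  by move=> oA; move/continuousP: cid => /(_ A oA).
have likeT : cantor_like T.
  split=> //; first by apply/perfectTP => x /TY; exact: perf.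
  move=> x y xy; have [U [[oU cU] Ux Uy]] := zY x y xy.
  by exists U; split=> //; split; [exact: oT|exact: clT].
have [f [cf _]] := homeomorphism_cantor_like likeT.
apply: (@homeomorphic_trans _ T); first by exists id; split=> //; exists g.
apply: homeomorphic_sym; exists f; apply: compact_hausdorff_homeomorphism => //.
- exact: cantor_space_compact.
- by move=> y; have [x _ <-] := @surj _ _ _ _ f y I; exists x.
Qed.

(** Each clopen set either contains a neighbourhood of [y] or misses one, so the index of the first
    set containing a point is locally constant. *)
Lemma near_find (I : Type) (C : I -> set Y) (s : seq I) (y : Y) :
  (forall x, clopen (C x)) ->
  \forall z \near y, find (fun x => `[< C x z >]) s = find (fun x => `[< C x y >]) s.
Proof.
move=> clC; elim: s => [|x s IH] /=; first exact: nearW.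
have [oC cC] := clC x; have [Cy|nCy] := asboolP (C x y).
  have : nbhs y (C x) by exact: open_nbhs_nbhs.
  by apply: filterS => z Cz; rewrite asboolT.
have : nbhs y (~` C x) by apply: open_nbhs_nbhs; split=> //; exact: closed_openC.
by apply: filterS2 IH => z -> nCz; rewrite asboolF.
Qed.

(* The charts are laid side by side in the line: the first chart of a finite
   subcover containing a point gives the integer part of its image. *)
Lemma cantor_of_clopen_charts (y0 : Y) (C : Y -> set Y) (q : Y -> Y -> R) :
  compact [set: Y] ->
  (forall y, clopen (C y) /\ C y y) ->
  (forall y z, C y z -> {for z, continuous (q y)} /\ 0 < q y z < 1) ->
  (forall y z w, C y z -> C y w -> q y z = q y w -> z = w) ->
  (forall y z w, C y z -> C y w -> z != w ->
    exists D : set Y, [/\ clopen D, D z & ~ D w]) ->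
  (forall y : Y, ~ open [set y]) -> homeomorphic Y cantor_space.
Proof.
move=> cY CP qP qI sep perf.
have [|s _ Ys] := compact_finite_subcover (U := C) cY.
  by move=> x _; have [[oC _] Cx] := CP x; exact: open_nbhs_nbhs.
pose i (y : Y) := find (fun x => `[< C x y >]) s.
pose F (y : Y) : R := (i y)%:R + q (nth y0 s (i y)) y.
have Ci y : C (nth y0 s (i y)) y.
  have [x xs Cxy] := Ys y I; apply/asboolP.
  apply: (nth_find y0 (a := fun x => `[< C x y >])); apply/hasP.
  by exists x => //; exact/asboolP.
apply: (cantor_of_embedding (F := F) y0) => //.
- move=> y A; rewrite /F => nA.
  have [cq _] := qP _ _ (Ci y).
  have cFy : {for y, continuous (fun z => (i y)%:R + q (nth y0 s (i y)) z)}.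
    by apply: cvgD; [exact: cvg_cst|exact: cq].
  have nI : \forall z \near y, i z = i y by apply: near_find => x; have [] := CP x.
  by apply: filterS2 nI (cFy _ nA) => z /= ->.
- move=> y z; rewrite /F => E.
  have [_ /andP[y1 y2]] := qP _ _ (Ci y); have [_ /andP[z1 z2]] := qP _ _ (Ci z).
  have iE : i y = i z.
    have le (m n : nat) (u v : R) : 0 < u -> v < 1 -> m%:R + u = n%:R + v -> (m <= n)%N.
      move=> u0 v1 E'; rewrite leqNgt; apply/negP; rewrite -(ler_nat R) -natr1; lra.
    by apply/eqP; rewrite eqn_leq (le _ _ _ _ y1 z2 E) (le _ _ _ _ z1 y2 (esym E)).
  move: E (Ci z); rewrite -iE => /addrI E Cz.
  exact: (qI _ _ _ (Ci y) Cz E).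
- move=> x y xy; have [clC Cx] := CP x.
  by have [Cy|nCy] := pselect (C x y); [exact: (sep x)|exists (C x)].
Qed.

End CantorEmbedding.

(** * Charts of a minimal set in the free interval *)

Section Charts.
Context {R : realType} {X : topologicalType}.
Implicit Types (a b t : R) (h k : R -> X).

Lemma free_interval_arc (J : set X) : free_interval R J ->
  exists k : R -> X, is_arc 0 1 k /\ k @` oo 0 1 = J.
Proof.
move=> [oJ [f [cf [g [cg fK gK]]]]].
have memI t : oo 0 1 t -> t \in (`]0, 1[%classic : set R).
  by move=> t01; apply/mem_set; rewrite -itv_ooE.
have valI (u : set_type (`]0, 1[%classic : set R)) : oo 0 1 (set_val u).
  by rewrite itv_ooE; exact: set_valP.
have half : oo 0 1 (1 / 2 : R) by apply/andP; split; lra.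
pose x0 := set_val (g (@exist _ _ (1 / 2) (memI _ half))).
(* Arcs are functions on the whole line; the default value [x0] is taken only outside [oo 0 1],
   where [is_arc] asks nothing. *)
pose k t := if pselect (oo 0 1 t) is left t01
            then set_val (g (@exist _ _ t (memI t t01))) else x0.
have kval u : k (set_val u) = set_val (g u).
  rewrite /k; case: pselect => [u01|]; last by case; exact: valI.
  by congr (set_val (g _)); apply: val_inj; rewrite -set_valE.
have kE t : oo 0 1 t -> exists2 u, set_val u = t & k t = set_val (g u).
  move=> t01; exists (@exist _ _ t (memI t t01)); first by rewrite set_valE.
  by rewrite -kval set_valE.
exists k; split; last first.
  apply/seteqP; split=> [_ [t /kE[u _ ->] <-]|x Jx]; first exact: set_valP.
  pose z : set_type J := @exist _ _ x (mem_set Jx).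
  by exists (set_val (f z)); [exact: valI|rewrite kval fK set_valE].
split=> [|s t /kE[u <- ->] /kE[v <- ->] E|t /[dup] t01 /kE[u ut ->] A].
- by [].
- by congr set_val; apply: (can_inj gK); exact: val_inj.
- split=> [nA|nB].
    have cvg_ : continuous (fun v => set_val (g v)).
      by move=> v; apply: continuous_comp; [exact: cg|exact: initial_continuous].
    have [_ [[W oW <-] Wu] WA] := cvg_ u A nA.
    apply: (filterS2 _ _ (nbhs_oo t01) (open_nbhs_nbhs (conj oW (_ : W t)))).
      by move=> s /kE[v <- kv] Wv; rewrite /= kv; exact: (WA v).
    by rewrite -ut.
  have nz : nbhs (g u) (fun z => A (k (set_val (f z)))).
    have cvf : continuous (fun z => set_val (f z)).
      by move=> z; apply: continuous_comp; [exact: cf|exact: initial_continuous].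
    by apply: (cvf (g u) (k @^-1` A)); rewrite /= gK ut.
  (* Since [J] is open in [X], a neighbourhood within [J] yields one in [X]. *)
  have [_ [[W oW <-] Wu] WA] := nz.
  have gJ : J (set_val (g u)) := set_valP (g u).
  apply: (filterS2 _ _ (open_nbhs_nbhs (conj oJ gJ)) (open_nbhs_nbhs (conj oW Wu))).
  move=> x Jx Wx; pose z : set_type J := @exist _ _ x (mem_set Jx).
  by have := WA z; rewrite /= kval fK !set_valE; exact.
Qed.

Lemma is_arc_homeo a b h (phi psi : X -> X) : is_arc a b h ->
  continuous phi -> continuous psi -> cancel phi psi -> cancel psi phi ->
  is_arc a b (psi \o h).
Proof.
move=> [ab hI hN] cphi cpsi phiK psiK.
split=> // [s t sab tab /(can_inj psiK)|t tab A]; first exact: hI.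
split=> [nA|]; first by apply/(hN _ tab (psi @^-1` A)); exact: (cpsi _ A nA).
move=> nB; have nP : nbhs (phi (psi (h t))) (psi @^-1` A).
  by rewrite psiK; apply/(hN _ tab (psi @^-1` A)).
have : nbhs (psi (h t)) (phi @^-1` (psi @^-1` A)) by exact: cphi.
by apply: filterS => x; rewrite /= phiK.
Qed.

Hypothesis hX : hausdorff_space X.

(** [M] misses the end points [k s] and [k t], so the preimage of the open arc equals that of the
    compact arc, which is closed. *)
Lemma clopen_slice a b (s t : R) k (M : set X) (phi : X -> X) :
  is_arc a b k -> continuous phi -> (forall x, M x -> M (phi x)) ->
  a < s -> t < b -> ~ M (k s) -> ~ M (k t) ->
  clopen [set y : set_type M | (k @` oo s t) (phi (set_val y))].
Proof.
move=> ak cphi Mphi as_ tb Ms Mt.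
have cf : continuous (fun y : set_type M => phi (set_val y)).
  by move=> y; apply: continuous_comp; [exact: initial_continuous|exact: cphi].
split.
  move/continuousP : cf => /(_ (k @` oo s t)); apply.
  exact: (arc_open ak (ltW as_) (ltW tb)).
have -> : [set y : set_type M | (k @` oo s t) (phi (set_val y))] =
    (fun y : set_type M => phi (set_val y)) @^-1` (k @` `[s, t]%classic).
  apply/seteqP; split=> y [u sut kuy].
    by exists u => //; rewrite /= in_itv /=; move: sut => /andP[? ?]; rewrite !ltW.
  exists u => //; move: sut; rewrite /= in_itv /= => /andP[su ut].
  have Mu : M (k u) by rewrite kuy; apply: Mphi; exact: set_valP.
  apply/andP; rewrite !lt_neqAle su ut !andbT; split.
    by apply: contra_notN Ms => /eqP ->.
  by apply: contra_notN Mt => /eqP <-.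
apply: closed_comp; first by move=> y _; exact: cf.
by apply: compact_closed => //; exact: (arc_segment_compact ak).
Qed.

(** As [M] has empty interior, [gap] finds a point outside [M] between any two parameters of [k].
    Gaps on both sides of the parameter [t] of [phi y] bound a clopen chart domain around [y], and a
    gap between two parameters separates the corresponding points. *)
Lemma nowhere_dense_cantor (M : set X) k : is_arc 0 1 k ->
  compact M -> M !=set0 -> interior M = set0 ->
  (forall x, M x -> ~ exists2 U, open U & U `&` M = [set x]) ->
  (forall x, M x -> exists phi : X -> X, [/\ continuous phi, injective phi,
     forall y, M y -> M (phi y) & (k @` oo 0 1) (phi x)]) ->
  is_cantor_set M.
Proof.
move=> ak cM [x0 Mx0] iM noiso chart.
have [_ kI kN] := ak.
have gap (s t : R) : 0 <= s -> s < t -> t <= 1 -> exists2 u, oo s t u & ~ M (k u).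
  move=> s0 st t1; apply: contrapT => N.
  have : interior M (k ((s + t) / 2)).
    apply: (filterS (P := k @` oo s t)).
      by move=> _ [u stu <-]; apply: contrapT => Mu; apply: N; exists u.
    apply: (arc_image_nbhs ak); first by apply/andP; split; lra.
    by apply: nbhs_oo; apply/andP; split; lra.
  by rewrite iM.
pose Y : topologicalType := set_type M.
have ex (y : Y) : exists C : set Y, exists q : Y -> R,
    [/\ clopen C, C y,
        forall z, C z -> {for z, continuous q} /\ 0 < q z < 1,
        forall z w, C z -> C w -> q z = q w -> z = w &
        forall z w, C z -> C w -> z != w ->
          exists D : set Y, [/\ clopen D, D z & ~ D w]].
  have [phi [cphi phiI phiM [t t01 kt]]] := chart _ (set_valP y).
  move: (t01) => /andP[t0 t1].
  have [p /andP[p0 pt] nMp] := gap 0 t (lexx 0) t0 (ltW t1).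
  have [r /andP[tr r1] nMr] := gap t 1 (ltW t0) t1 (lexx 1).
  pose kinv x := get [set u | oo 0 1 u /\ k u = x].
  have kinvK u : oo 0 1 u -> kinv (k u) = u.
    move=> u01; have [H1 H2] : [set v | oo 0 1 v /\ k v = k u] (kinv (k u)).
      by apply: getPex; exists u.
    exact: kI.
  have sub01 (u v w : R) : 0 <= u -> v <= 1 -> oo u v w -> oo 0 1 w.
    by move=> u0 v1 /andP[? ?]; apply/andP; split; lra.
  have pr01 w (prw : oo p r w) := sub01 p r w (ltW p0) (ltW r1) prw.
  exists [set z | (k @` oo p r) (phi (set_val z))], (fun z => kinv (phi (set_val z))).
  split.
  - exact: (clopen_slice ak).
  - by exists t => //; apply/andP.
  - move=> z [u pru kuz]; split; last first.
      by rewrite -kuz kinvK; exact: pr01.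
    have cz : continuous (fun z : Y => phi (set_val z)).
      by move=> z'; apply: continuous_comp; [exact: initial_continuous|exact: cphi].
    move=> A; rewrite -kuz kinvK; last exact: pr01.
    move=> nA.
    have nk : nbhs (phi (set_val z)) (k @` (A `&` oo 0 1)).
      rewrite -kuz; apply: (arc_image_nbhs ak); first exact: pr01.
      by apply: filterI => //; apply: nbhs_oo; exact: pr01.
    have nz : nbhs z [set z' : Y | (k @` (A `&` oo 0 1)) (phi (set_val z'))].
      exact: (cz z _ nk).
    by apply: filterS nz => z' [v [Av v01] kv]; rewrite /= -kv kinvK.
  - move=> z w [u pru kuz] [v prv kvw]; rewrite -kuz -kvw.
    rewrite (kinvK u (pr01 u pru)) (kinvK v (pr01 v prv)) => uv.
    by apply: val_inj; rewrite -!set_valE; apply: phiI; rewrite -kuz -kvw uv.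
  - move=> z w [u pru kuz] [v prv kvw] zw.
    (* The roles of [z] and [w] are exchanged by passing to the complement of [D]. *)
    wlog uv : u v z w zw pru prv kuz kvw / u < v.
      move=> H; have [uv|vu|uv] := ltgtP u v.
      - exact: (H u v z w).
      - have wz : w != z by rewrite eq_sym.
        have [D [clD Dw nDz]] := H v u w z wz prv pru kvw kuz vu.
        by exists (~` D); split=> //; exact: clopenC.
      - move/eqP: zw; case; apply: val_inj; rewrite -!set_valE; apply: phiI.
        by rewrite -kuz -kvw uv.
    have [/andP[u0 u1] /andP[v0 v1]] := (pr01 u pru, pr01 v prv).
    have [e /andP[ue ev] nMe] := gap u v (ltW u0) uv (ltW v1).
    exists [set z | (k @` oo p e) (phi (set_val z))]; split.
    + by apply: (clopen_slice ak) => //; lra.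
    + by exists u => //; move: pru => /andP[pu _]; apply/andP.
    + move=> [e' /andP[pe ee] ke]; have : e' = v.
        by apply: kI; [apply/andP; split; lra|apply/andP|rewrite ke].
      lra.
pose C y := projT1 (cid (ex y)).
pose q y := projT1 (cid (projT2 (cid (ex y)))).
have CqP y : _ := projT2 (cid (projT2 (cid (ex y)))).
apply: (@cantor_of_clopen_charts R Y (@exist _ _ x0 (mem_set Mx0)) C q).
- exact: compact_set_type.
- by move=> y; have [] := CqP y.
- by move=> y; have [] := CqP y.
- by move=> y; have [] := CqP y.
- by move=> y; have [] := CqP y.
(* A point that is open in the subspace [M] would be isolated in [M]. *)
move=> y [U oU Uy]; apply: (noiso _ (set_valP y)); exists U => //.
apply/seteqP; split=> [x [Ux Mx]|_ ->].
  have : (set_val @^-1` U) (@exist _ _ x (mem_set Mx) : set_type M).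
    by rewrite /= set_valE.
  by rewrite Uy => <-.
split; last exact: set_valP.
have : (set_val @^-1` U) y by rewrite Uy.
by [].
Qed.

End Charts.

(** * Minimal sets *)

Lemma continuous_closure (X Y : topologicalType) (f : X -> Y) (A : set X) :
  continuous f -> f @` closure A `<=` closure (f @` A).
Proof.
move=> cf _ [x clx <-] B nB; have [y [Ay By]] := clx _ (cf _ _ nB).
by exists (f y); split=> //; exists y.
Qed.

Lemma homeomorphic_infinite (X Z : topologicalType) (M : set X) (e : nat -> Z) :
  homeomorphic (set_type M) Z -> injective e -> ~ finite_set M.
Proof.
move=> [f [_ [g [_ fK gK]]]] eI finM; apply: infinite_nat.
have gI : injective (fun n => set_val (g (e n))).
  move=> m n E; apply/eI/(can_inj gK)/val_inj; by rewrite -!set_valE.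
have -> : [set: nat] = (fun n => set_val (g (e n))) @^-1` M.
  by apply/seteqP; split=> // n _; exact: set_valP.
by apply: finite_preimage => // m n _ _; exact: gI.
Qed.

(** The indicator sequences of single integers are pairwise distinct points. *)
Lemma cantor_infinite (X : topologicalType) (M : set X) :
  is_cantor_set M -> ~ finite_set M.
Proof.
move=> hM; apply: (@homeomorphic_infinite _ _ M
  ((fun n m => m == n) : nat -> cantor_space)) => // m n E.
by have := congr1 (fun u : nat -> bool => u m) E; rewrite eqxx => /esym/eqP.
Qed.

(** A point of [M] supplies the index [i] of a circle, which excludes [n = 0]. That circle has
    distinct points at the parameters [1 / (m + 1)]. *)
Lemma union_of_circles_infinite (R : realType) (X : topologicalType) (M : set X) :
  M !=set0 -> is_finite_union_of_circles R M -> ~ finite_set M.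
Proof.
move=> [x Mx] [n hM].
have [f _] := hM; have [i p0] := f (@exist _ _ x (mem_set Mx)).
have pn (m : nat) : exists p : circle R, circle_param p = m.+1%:R^-1.
  have i0 : 0 < m.+1%:R^-1 :> R by rewrite invr_gt0.
  have i1 : m.+1%:R^-1 <= 1 :> R by rewrite invf_le1 // ler1n.
  apply: circle_param_surj; rewrite i1 andbT.
  by apply: lt_trans i0; rewrite oppr_lt0.
pose e (m : nat) : {i : 'I_n & circle R} := existT _ i (projT1 (cid (pn m))).
apply: (homeomorphic_infinite (e := e) hM) => k m E.
have := congr1 (fun z : {i : 'I_n & circle R} => circle_param (projT2 z)) E.
rewrite /= (projT2 (cid (pn k))) (projT2 (cid (pn m))) => /invr_inj /eqP.
by rewrite eqr_nat eqSS => /eqP.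
Qed.

Section MinimalSets.
Context {S : addSemigroupType} {X : topologicalType}.
Variables (Phi : discrete_topology S * X -> X) (M : set X).
Hypothesis X_hausdorff : hausdorff_space X.
Hypothesis X_compact : compact [set: X].
Hypothesis Phi_action : is_action Phi.
Hypothesis M_minimal : minimal_set Phi M.
Hypothesis Phi_homeo : forall s : S, homeomorphism (acting_map Phi s).

Let phi := acting_map Phi.

Lemma acting_map_add s t x : phi s (phi t x) = phi (s + t) x.
Proof. exact: Phi_action.2. Qed.

Lemma acting_map_continuous s : continuous (phi s).
Proof. by have [] := Phi_homeo s. Qed.

Lemma acting_map_inj s : injective (phi s).
Proof. by have [_ [g [_ gK _]]] := Phi_homeo s; exact: can_inj gK. Qed.

Lemma minimal_sub s x : M x -> M (phi s x).
Proof. by move=> Mx; have [[_ _ +] _] := M_minimal; apply; exists x. Qed.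

Lemma minimal_closed : closed M.
Proof. by have [[]] := M_minimal. Qed.

Lemma minimal_eq N : nonempty_closed_invariant Phi N -> N `<=` M -> N = M.
Proof.
move=> HN NM; apply/seteqP; split=> //; apply: contrapT => MN.
by have [_ /(_ N HN)] := M_minimal; apply.
Qed.

Lemma minimal_image s : phi s @` M = M.
Proof.
apply: minimal_eq; last by move=> _ [x Mx <-]; exact: minimal_sub.
have [[x Mx] _ _] := M_minimal.1; split.
- by exists (phi s x); exists x.
- apply: compact_closed => //; apply: continuous_compact.
    exact/continuous_subspaceT/acting_map_continuous.
  exact: subclosed_compact minimal_closed X_compact _.
- move=> t _ [_ [y My <-] <-]; exists (phi t y); first exact: minimal_sub.
  rewrite -[LHS]/(phi s (phi t y)) -[RHS]/(phi t (phi s y)) !acting_map_add.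
  by rewrite Algebra.addrC.
Qed.

(** [phi s] is injective and maps [M] onto [M]. This is what allows subsets of [M] to be pulled back
    along acting maps without leaving [M]. *)
Lemma minimal_preimage s x : M (phi s x) -> M x.
Proof.
move=> Msx; have [y My /acting_map_inj <- //] : (phi s @` M) (phi s x).
by rewrite minimal_image.
Qed.

Lemma minimal_visits (s0 : S) x (U : set X) : M x -> open U -> U `&` M !=set0 ->
  exists s, U (phi s x).
Proof.
move=> Mx oU [y [Uy My]].
(* The semigroup may have no neutral element, so [x] itself need not be in [orb]; [s0] shows that
   [orb] is nonempty. Its closure is invariant and contained in [M], hence all of [M]. *)
pose orb := range (phi^~ x).
have orbM : closure orb = M.
  apply: minimal_eq; last first.
    rewrite [X in _ `<=` X](closure_id M).1; last exact: minimal_closed.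
    by apply: closureS => _ [s _ <-]; exact: minimal_sub.
  split; first by exists (phi s0 x); apply: subset_closure; exists s0.
    exact: closed_closure.
  move=> s z /(continuous_closure (@acting_map_continuous s)).
  apply: closureS => _ [_ [t _ <-] <-]; exists (s + t) => //.
  by rewrite acting_map_add.
move: My; rewrite -orbM => /(_ U (open_nbhs_nbhs (conj oU Uy))).
by move=> [_ [[s _ <-] Us]]; exists s.
Qed.

End MinimalSets.

(** * Local properties spread over a minimal set *)

Section MinimalTrichotomy.
Context {R : realType} {S : addSemigroupType} {X : topologicalType}.
Variables (Phi : discrete_topology S * X -> X) (M : set X).
Hypothesis X_hausdorff : hausdorff_space X.
Hypothesis X_compact : compact [set: X].
Hypothesis Phi_action : is_action Phi.
Hypothesis M_minimal : minimal_set Phi M.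
Hypothesis Phi_homeo : forall s : S, homeomorphism (acting_map Phi s).
Variable s0 : S.

Let M_compact : compact M.
Proof.
exact: subclosed_compact (minimal_closed M_minimal) X_compact _.
Qed.

Let visits x (U : set X) : M x -> open U -> U `&` M !=set0 ->
  exists s, U (acting_map Phi s x).
Proof. exact: (minimal_visits Phi_action M_minimal Phi_homeo s0). Qed.

(** Each [y] in [M] is moved into [U], hence to [x], by some acting map. By injectivity the preimage
    of [U] meets [M] in [y] alone, and finitely many such neighbourhoods cover [M]. *)
Lemma minimal_isolated_finite x (U : set X) :
  open U -> U `&` M = [set x] -> finite_set M.
Proof.
move=> oU UMx; have [Ux Mx] : (U `&` M) x by rewrite UMx.
have iso y : M y -> exists V : set X, nbhs y V /\ V `&` M `<=` [set y].
  move=> My; have [|s Us] := visits My oU; first by exists x.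
  exists (acting_map Phi s @^-1` U); split.
    by apply: (acting_map_continuous Phi_homeo); exact: open_nbhs_nbhs.
  move=> z [Uz Mz]; apply: (acting_map_inj Phi_homeo (s := s)).
  have eqx w : U (acting_map Phi s w) -> M w -> acting_map Phi s w = x.
    move=> Uw Mw; have : (U `&` M) (acting_map Phi s w).
      by split=> //; exact: (minimal_sub M_minimal).
    by rewrite UMx.
  by rewrite (eqx z Uz Mz) (eqx y Us My).
pose V y := if pselect (M y) is left My then projT1 (cid (iso y My)) else setT.
have VP y : M y -> nbhs y (V y) /\ V y `&` M `<=` [set y].
  by rewrite /V; case: pselect => // My _; exact: projT2 (cid (iso y My)).
have [|s sM Ms] := compact_finite_subcover (U := V) M_compact.
  by move=> y /VP[].
apply: sub_finite_set (finite_seq s) => y My /=.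
have [z zs Vzy] := Ms y My; have [_ Vz] := VP z (sM z zs).
by have -> : y = z by apply: Vz.
Qed.

(** If an acting map sends [y] into the interior of [M], the preimage of [M] is a neighbourhood of
    [y], contained in [M] by [minimal_preimage]. *)
Lemma minimal_interior_open : interior M !=set0 -> open M.
Proof.
move=> [x iMx]; rewrite openE => y My.
have [|s iMs] := visits My (@open_interior _ M).
  by exists x; split=> //; exact: interior_subset.
have : nbhs y (acting_map Phi s @^-1` M) by exact: (acting_map_continuous Phi_homeo).
apply: filterS => z.
exact: (minimal_preimage X_hausdorff X_compact Phi_action M_minimal Phi_homeo).
Qed.

Lemma minimal_open_circles (k : R -> X) : is_arc 0 1 k ->
  M `&` k @` oo 0 1 !=set0 -> open M -> is_finite_union_of_circles R M.
Proof.
move=> ak [x [Mx kx]] oM.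
have loc y : M y -> exists V : set X, [/\ is_arcset R V, V y & V `<=` M].
  have oJ := arc_open ak (lexx 0) (lexx 1).
  move=> My; have [|s [[t t01 kt] Ms]] := visits My (openI oJ oM).
    by exists x.
  have [cphi [psi [cpsi phiK psiK]]] := Phi_homeo s.
  have [_ _ kN] := ak.
  have /nbhs_ex_oo[e e0 eM] : nbhs t (k @^-1` M).
    by apply/(kN t t01); rewrite kt; exact: open_nbhs_nbhs.
  move: t01 => /andP[t0 t1].
  (* The chart is cut down to parameters around [t] whose images under [k] stay in [M]; the inverse
     [psi] of the acting map carries this piece back to an arc around [y]. *)
  pose a := Num.max 0 (t - e); pose b := Num.min 1 (t + e).
  have [a0 ae at_] : [/\ 0 <= a, t - e <= a & a < t].
    by rewrite /a !le_max !lexx orbT gt_max t0 /=; split=> //; lra.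
  have [b1 be tb] : [/\ b <= 1, b <= t + e & t < b].
    by rewrite /b !ge_min !lexx orbT lt_min t1 /=; split=> //; lra.
  have ak' := is_arc_sub ak a0 b1 (lt_trans at_ tb).
  exists ((psi \o k) @` oo a b); split.
  - exists a, b, (psi \o k); split=> //.
    exact: is_arc_homeo ak' cphi cpsi phiK psiK.
  - by exists t; [apply/andP|rewrite /= kt phiK].
  - move=> _ [u /andP[au ub] <-].
    apply: (minimal_preimage X_hausdorff X_compact Phi_action M_minimal
      Phi_homeo (s := s)).
    by rewrite psiK; apply: eM; apply/andP; split; lra.
pose V y := if pselect (M y) is left My then projT1 (cid (loc y My)) else setT.
have VP y : M y -> [/\ is_arcset R (V y), V y y & V y `<=` M].
  by rewrite /V; case: pselect => // My _; exact: projT2 (cid (loc y My)).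
have [|s sM Ms] := compact_finite_subcover (U := V) M_compact.
  by move=> y /VP[aV Vy _]; apply: open_nbhs_nbhs; split=> //; exact: is_arcset_open aV.
apply: loop_cover_union_of_circles => // y My.
have [aV Vy VM] := VP y My.
have sV z : z \in s -> is_arcset R (V z) /\ V z `<=` M by move=> /sM /VP[].
have [C [lC oC VC CM]] := arcset_sub_loop X_hausdorff M_compact sV Ms aV VM.
by exists C; split=> //; exact: VC.
Qed.

End MinimalTrichotomy.

Theorem corollary19 (R : realType) (X : topologicalType) (J : set X)
    (S : addSemigroupType) (Phi : discrete_topology S * X -> X) (M : set X)
    (X_compact : compact [set: X]) (X_hausdorff : hausdorff_space X)
    (J_free : free_interval R J)
    (S_nonempty : inhabited S) (Phi_action : is_action Phi)
    (M_minimal : minimal_set Phi M) (M_meets_J : M `&` J !=set0)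
    (Phi_homeo : forall s : S, homeomorphism (acting_map Phi s)) :
  exactly_one (finite_set M)
              (open M /\ is_finite_union_of_circles R M)
              (nowhere_dense M /\ is_cantor_set M).
Proof.
case: S_nonempty => s0.
have M0 : M !=set0 by have [[]] := M_minimal.
have clM := minimal_closed M_minimal.
have cM : compact M by exact: subclosed_compact clM X_compact _.
have [k [ak kJ]] := free_interval_arc J_free.
split; last split.
- have [iM|niM] := pselect (interior M !=set0).
    have oM := minimal_interior_open X_hausdorff X_compact Phi_action M_minimal
      Phi_homeo s0 iM.
    constructor 2; split=> //.
    apply: (minimal_open_circles X_hausdorff X_compact Phi_action M_minimal
      Phi_homeo s0 ak) => //.
    by rewrite kJ.
  have iM0 : interior M = set0.
    by apply/eqP; apply: contrapT => /negP/set0P.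
  have [[x [U [oU UMx]]]|noiso] :=
      pselect (exists x, exists U : set X, open U /\ U `&` M = [set x]).
    constructor 1.
    exact: (minimal_isolated_finite X_compact Phi_action M_minimal Phi_homeo s0 oU UMx).
  constructor 3; split; first by rewrite /nowhere_dense -(closure_id M).1.
  apply: (nowhere_dense_cantor X_hausdorff ak) => //.
    by move=> x _ [U oU UMx]; apply: noiso; exists x, U.
  move=> x Mx.
  have [|s Js] := minimal_visits Phi_action M_minimal Phi_homeo s0 Mx (U := J) J_free.1.
    by rewrite setIC.
  exists (acting_map Phi s); split.
  + exact: (acting_map_continuous Phi_homeo).
  + exact: (acting_map_inj Phi_homeo).
  + by move=> y; exact: (minimal_sub M_minimal).
  + by rewrite kJ.
- by move=> [finM [_ /(union_of_circles_infinite M0)]].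
- by move=> [finM [_ /cantor_infinite]].
(* A nonempty open set is contained in the interior of its closure, so it is not nowhere dense. *)
- move=> [[oM _] [ndM _]]; have [x Mx] := M0.
  have : interior (closure M) x.
    by apply: filterS (@subset_closure _ M) _; exact: open_nbhs_nbhs.
  by rewrite ndM.
Qed.
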